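(* Let $\mathbb B=\mathbb B^n$ be the open Euclidean unit ball in $\mathbb C^n$, let $w\in\mathbb B$, let $\theta_w$ be a bi-holomorphic automorphism of $\mathbb B$ with $\theta_w(w)=0$, and let $\boldsymbol T\in\mathrm B_1(\mathbb B)$. If the homomorphism $\rho_{N_{\boldsymbol T}(w)}$ of $\mathcal O(\mathbb B)$ induced by the localization $N_{\boldsymbol T}(w)$ is contractive, then $$\mathcal K_{\boldsymbol T}(w)\le -D\theta_w(w)^{\rm t}\,\overline{D\theta_w(w)}=\mathcal K_{\mathfrak B}(w)$$ in the usual ordering of Hermitian matrices.
   Context: $\mathrm B_1(\Omega)$, for a bounded domain $\Omega\subset\mathbb C^n$, is the class of $n$-tuples $\boldsymbol T=(T_1,\ldots,T_n)$ of commuting bounded operators on a Hilbert space $\mathcal H$ such that: (1) $\dim\bigcap_k\ker(T_k-w_kI)=1$ for $w\in\Omega$; (2) for $w\in\Omega$ the operator $h\mapsto((T_1-w_1I)h,\ldots,(T_n-w_nI)h)$ has closed range; (3) the closed linear span of these joint kernels over $w\in\Omega$ is $\mathcal H$. If $\gamma$ is a (local) non-vanishing holomorphic map with $\gamma(w)\in\bigcap_k\ker(T_k-w_kI)$, the curvature matrix is $\mathcal K_{\boldsymbol T}(w)=-\big(\frac{\partial^2}{\partial w_i\partial\bar w_j}\log\|\gamma(w)\|^2\big)_{i,j=1}^n$, independent of $\gamma$. $N_{\boldsymbol T}(w)$ is the restriction of $\boldsymbol T$ to the $(n+1)$-dimensional space $\bigcap_{i,j}\ker(T_i-w_iI)(T_j-w_jI)$,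 and $\mathcal O(\mathbb B)$ is the algebra of functions holomorphic in a neighborhood of $\overline{\mathbb B}$. The induced homomorphism is $\rho_{N_{\boldsymbol T}(w)}(f)=f(N_{\boldsymbol T}(w))$; explicitly, in a suitable orthonormal basis, $\rho_{N_{\boldsymbol T}(w)}(f)=\left(\begin{smallmatrix}f(w)&\nabla f(w)A(w)^{\rm t}\\0&f(w)I_n\end{smallmatrix}\right)$ where $A(w)^{\rm t}\overline{A(w)}=(-\mathcal K_{\boldsymbol T}(w)^{\rm t})^{-1}$. Contractive means $\|\rho_{N_{\boldsymbol T}(w)}(f)\|\le\sup_{\mathbb B}|f|$ for all $f\in\mathcal O(\mathbb B)$. $D\theta_w(w)$ is the complex Jacobian matrix of $\theta_w$ at $w$. $\mathfrak B(z,w)=(1-\langle z,w\rangle)^{-1}$ and $\mathcal K_{\mathfrak B}(w)=-\big(\frac{\partial^2}{\partial w_i\partial\bar w_j}\log\mathfrak B(w,w)\big)_{i,j=1}^n$. *)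

(* Defs.v *)
From HB Require Import structures.
From mathcomp Require Import all_boot all_order all_algebra.
From mathcomp Require Import sesquilinear spectral.
From mathcomp Require Import complex.
From mathcomp Require Import all_classical all_reals all_analysis.

Set Implicit Arguments.
Unset Strict Implicit.
Unset Printing Implicit Defensive.

Import Order.TTheory GRing.Theory Num.Theory.
Import numFieldNormedType.Exports.

Local Open Scope classical_set_scope.
Local Open Scope ring_scope.
Local Open Scope complex_scope.

(* R[i] packed as a numClosedFieldType: its topology and its norm as a module
   over itself are those the library attaches to any numClosedFieldType. *)
Definition Cplx (R : realType) : numClosedFieldType := R[i].

Section SeveralComplexVariables.
Context {R : realType} {n : nat}.
Local Notation C := (Cplx R).

Definition unit_ball : set 'rV[C]_n := [set z | dotmx z z < 1].

(* Differentiability is over the scalar field R[i], i.e. it is complex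
   (Frechet) differentiability. *)
Definition holomorphic_on (V : normedModType C) (U : set 'rV[C]_n)
    (f : 'rV[C]_n -> V) : Prop :=
  open U /\ forall z, U z -> differentiable f z.

Definition holomorphic_near_closed_ball (f : 'rV[C]_n -> C) : Prop :=
  exists2 U, closure unit_ball `<=` U & holomorphic_on U f.

Definition automorphism_of (U : set 'rV[C]_n)
    (theta : 'rV[C]_n -> 'rV[C]_n) : Prop :=
  [/\ holomorphic_on U theta, (forall z, U z -> U (theta z)) &
    exists psi : 'rV[C]_n -> 'rV[C]_n,
      [/\ holomorphic_on U psi, (forall z, U z -> U (psi z)),
          (forall z, U z -> psi (theta z) = z) &
          (forall z, U z -> theta (psi z) = z)]].

(* Entry (k, j) is the derivative of the k-th component of theta in the j-th
   variable; the library's jacobian acts on row vectors from the right, hence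
   the transposition. *)
Definition jacobian_matrix (theta : 'rV[C]_n -> 'rV[C]_n) (w : 'rV[C]_n) :
    'M[C]_n :=
  (jacobian theta w)^T.

Definition partial (k : 'I_n) (f : 'rV[C]_n -> C) (w : 'rV[C]_n) : C :=
  'D_(delta_mx 0 k) f w.

(* Derivative of g along v with respect to a real parameter. *)
Definition real_derive (v : 'rV[C]_n) (g : 'rV[C]_n -> C) (z : 'rV[C]_n) : C :=
  derive1 (fun t : R => complex.Re (g (z + t%:C *: v))) 0 +i*
  derive1 (fun t : R => complex.Im (g (z + t%:C *: v))) 0.

(* Wirtinger derivatives: d/dw_k = (d/dx_k - i d/dy_k) / 2 and
   d/d(conj w_k) = (d/dx_k + i d/dy_k) / 2. *)
Definition wirtinger (k : 'I_n) (g : 'rV[C]_n -> C) (z : 'rV[C]_n) : C :=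
  (real_derive (delta_mx 0 k) g z
   - 'i * real_derive ('i *: delta_mx 0 k) g z) / 2.

Definition wirtinger_bar (k : 'I_n) (g : 'rV[C]_n -> C) (z : 'rV[C]_n) : C :=
  (real_derive (delta_mx 0 k) g z
   + 'i * real_derive ('i *: delta_mx 0 k) g z) / 2.

(* F is meant to take positive real values. *)
Definition curvature (F : 'rV[C]_n -> C) (w : 'rV[C]_n) : 'M[C]_n :=
  - \matrix_(i, j)
      wirtinger i (wirtinger_bar j (fun z => (ln (complex.Re (F z)))%:C)) w.

Definition ball_kernel (z w : 'rV[C]_n) : C := (1 - dotmx z w)^-1.

Definition ball_curvature (w : 'rV[C]_n) : 'M[C]_n :=
  curvature (fun z => ball_kernel z z) w.

Definition hermitian_le (A B : 'M[C]_n) : Prop :=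
  [/\ A \is hermsymmx, B \is hermsymmx &
    forall x : 'rV[C]_n, 0 <= (x *m (B - A) *m (map_mx Num.conj x)^T) 0 0].

End SeveralComplexVariables.

Section CowenDouglas.
Context {R : realType} {n : nat}.
Local Notation C := (Cplx R).

Definition is_hilbert (H : completeNormedModType C) (dot : {dot H for Num.conj}) :
    Prop :=
  forall x : H, dot x x = `|x| ^+ 2.

Context {H : completeNormedModType C}.

Definition linear_span (S : set H) : set H :=
  [set x | exists (m : nat) (c : 'I_m -> C) (v : 'I_m -> H),
    (forall i, S (v i)) /\ x = \sum_i c i *: v i].

Variable T : 'I_n -> {linear H -> H}.

(* T_k - w_k I *)
Definition shifted (w : 'rV[C]_n) (k : 'I_n) (h : H) : H := T k h - w 0 k *: h.

Definition joint_kernel (w : 'rV[C]_n) : set H :=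
  [set h | forall k, shifted w k h = 0].

Definition cowen_douglas1 (Omega : set 'rV[C]_n) : Prop :=
  [/\ (forall k, continuous (T k)),
      (forall i j h, T i (T j h) = T j (T i h)),
      (forall w, Omega w -> exists2 v : H, v != 0 &
         joint_kernel w = [set c *: v | c in [set: C]]),
      (forall w, Omega w ->
         closed (range (fun h : H => \row_k shifted w k h : 'rV[H]_n))) &
      closure (linear_span (\bigcup_(w in Omega) joint_kernel w)) = [set: H]].

(* gamma is a local holomorphic frame of the line bundle of joint kernels. *)
Definition kernel_frame (w : 'rV[C]_n) (gamma : 'rV[C]_n -> H) : Prop :=
  exists U : set 'rV[C]_n, [/\ U w, holomorphic_on U gamma &
    forall z, U z -> gamma z != 0 /\ joint_kernel z (gamma z)].

(* K is the curvature matrix of T at w.  The frame gamma is auxiliary: any two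
   differ by a nowhere vanishing holomorphic factor, which leaves K unchanged. *)
Definition is_curvature_of (w : 'rV[C]_n) (K : 'M[C]_n) : Prop :=
  exists2 gamma : 'rV[C]_n -> H, kernel_frame w gamma &
    K = curvature (fun z => `|gamma z| ^+ 2) w.

(* The space on which the localization N_T(w) acts. *)
Definition localization_space (w : 'rV[C]_n) : set H :=
  [set h | forall i j, shifted w i (shifted w j h) = 0].

(* f(N_T(w)), as an operator on localization_space w.  As the products
   (N_i - w_i)(N_j - w_j) all vanish, the Taylor series of f at w evaluated at
   N_T(w) stops after its linear term. *)
Definition localization_hom (w : 'rV[C]_n) (f : 'rV[C]_n -> C) (h : H) : H :=
  f w *: h + \sum_k partial k f w *: shifted w k h.

(* The lemmas down to localization_hom_coord show that f |-> localization_hom w f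
   is a unital algebra homomorphism into the operators on localization_space w,
   sending the k-th coordinate function to the restriction of T_k. *)
Lemma shifted_is_linear w k : linear (shifted w k).
Proof.
move=> a x y; rewrite /shifted linearP scalerDr scalerBr opprD addrACA.
by rewrite !scalerA [w 0 k * a]mulrC.
Qed.

HB.instance Definition _ w k :=
  GRing.isLinear.Build C H H _ (shifted w k) (@shifted_is_linear w k).

Lemma shifted_localization_hom w f h k : localization_space w h ->
  shifted w k (localization_hom w f h) = f w *: shifted w k h.
Proof.
move=> Mh; rewrite /localization_hom linearD linearZ /= linear_sum.
by rewrite big1 ?addr0// => j _; rewrite linearZ /= Mh scaler0.
Qed.

Lemma localization_hom_space w f h :
  localization_space w h -> localization_space w (localization_hom w f h).
Proof.
by move=> Mh i j; rewrite shifted_localization_hom// linearZ /= Mh scaler0.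
Qed.

Lemma localization_hom_cst w c h : localization_hom w (cst c) h = c *: h.
Proof.
rewrite /localization_hom big1 ?addr0// => k _.
by rewrite /partial derive_cst scale0r.
Qed.

Lemma localization_homD (w : 'rV[C]_n) (f g : 'rV[C]_n -> C) h :
  differentiable f w -> differentiable g w ->
  localization_hom w (f \+ g) h = localization_hom w f h + localization_hom w g h.
Proof.
move=> df dg; rewrite /localization_hom addrACA -scalerDl; congr +%R.
rewrite -big_split; apply: eq_bigr => k _ /=.
by rewrite /partial deriveD -?scalerDl//; exact: diff_derivable.
Qed.

Lemma localization_homM (w : 'rV[C]_n) (f g : 'rV[C]_n -> C) h :
  differentiable f w -> differentiable g w -> localization_space w h ->
  localization_hom w (f \* g) h = localization_hom w f (localization_hom w g h).
Proof.
move=> df dg Mh; rewrite {2}/localization_hom.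
under eq_bigr do rewrite shifted_localization_hom//.
rewrite /localization_hom scalerDr scalerA -addrA; congr +%R.
rewrite scaler_sumr -big_split; apply: eq_bigr => k _ /=.
rewrite /partial deriveM; [|exact: diff_derivable..].
rewrite scalerDl !scalerA; congr (_ + _ *: _); exact: mulrC.
Qed.

Lemma localization_hom_coord w j h :
  localization_hom w (fun z => z 0 j) h = T j h.
Proof.
have D k : partial k (fun z : 'rV[C]_n => z 0 j) w = (k == j)%:R.
  rewrite /partial /derive; apply: (@lim_near_cst _ _ _ _ _ _) => //.
  near=> t; rewrite /= !mxE /= addrK.
  rewrite [LHS]mulrA mulVf ?mul1r ?eqxx 1?[j == k]eq_sym//.
  by near: t; exact: nbhs_dnbhs_neq.
rewrite /localization_hom.
under eq_bigr do rewrite D scaler_nat mulrb.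
by rewrite -big_mkcond big_pred1_eq /= /shifted addrC subrK.
Unshelve. all: by end_near. Qed.

(* Suprema are taken in the extended reals, so no boundedness is presupposed. *)
Definition op_norm_on (M : set H) (A : H -> H) : \bar R :=
  ereal_sup [set (complex.Re `|A h|)%:E | h in M `&` [set h | `|h| <= 1]].

Definition sup_norm_on (U : set 'rV[C]_n) (f : 'rV[C]_n -> C) : \bar R :=
  ereal_sup [set (complex.Re `|f z|)%:E | z in U].

Definition contractive_localization (w : 'rV[C]_n) : Prop :=
  forall f, holomorphic_near_closed_ball f ->
    (op_norm_on (localization_space w) (localization_hom w f)
       <= sup_norm_on unit_ball f)%E.

End CowenDouglas.

(* Main.v *)
(* The curvature of T at w is - G / |gam w|^2, where G is the Gram matrix of the
   components of the derivatives of a frame gam orthogonal to gam w.  Since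
   (T_k - w_k) d_i gam(w) = delta_ik gam w, the localization acts on these
   derivatives explicitly, and applying contractivity to f(z) = <phi_w(z), v>,
   with phi_w the Moebius automorphism exchanging 0 and w and v a unit vector,
   bounds G from below by Dphi_w(w)^t conj(Dphi_w(w)) after optimizing over v.
   By Schwarz's lemma theta o phi_w has a unitary derivative at 0, so theta and
   phi_w give the same matrix, which is computed to be - K_B(w).

   Functions are only assumed to be complex differentiable at each point, so
   Schwarz's lemma is derived from Goursat's argument on rectangles.  Its
   consequence |D_v F| <= 2 M |v| / r, applied repeatedly to increments of F,
   yields the second derivatives of the frame that the curvature involves. *)

Require Import Defs.
From mathcomp Require Import all_boot all_order all_algebra.
From mathcomp Require Import sesquilinear spectral complex.
From mathcomp Require Import all_classical all_reals all_analysis.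
From mathcomp Require Import ring lra.
Import Order.TTheory GRing.Theory Num.Theory.
Import numFieldNormedType.Exports.
Local Open Scope classical_set_scope.
Local Open Scope ring_scope.
Local Open Scope complex_scope.

Set Implicit Arguments.
Unset Strict Implicit.
Unset Printing Implicit Defensive.

(** * Goursat's theorem on rectangles *)

Section Goursat.
Context {R : realType}.
Implicit Types (a b c d : R) (f g : R -> R).

(** The test functions are built on the Moebius map and not on [theta] because [theta] is only
    assumed holomorphic on the open ball, while contractivity speaks of functions holomorphic around
    the closed ball; the denominator [1 - dotmx z w] has no zero on the closure, so [mobius]
    qualifies. This is what forces the comparison of the two maps. The matrix inequality is tested
    on one vector [x] at a time. Let [g = gam w] and let [h] be the component of ['D_x gam w]
    orthogonal to [g]. When [f w = 0], the localization sends [h] to [g] times the derivative of [f]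
    along [x], so contractivity compares [|h|^2] with [|g|^2], and [|h|^2 / |g|^2] is the value at
    [x] of the form with matrix [- KT]. Second derivatives of the frame only have to exist: they
    enter through a term antilinear in the direction, which d/dw_i annihilates. A bound on the real
    part suffices in Schwarz's lemma, since it is always applied to the pairing of a map with its
    own derivative at 0, whose derivative there is a nonnegative real number. *)

Definition segment_integral a b f : R :=
  Rintegral (@lebesgue_measure R) `[a, b]%classic f.

Definition continuous_on_segment a b f : Prop :=
  forall x, a <= x <= b -> {for x, continuous f}.

Lemma continuous_on_segment_integrable a b f : continuous_on_segment a b f ->
  (@lebesgue_measure R).-integrable `[a, b] (EFin \o f).
Proof.
move=> cf; apply: continuous_compact_integrable; first exact: segment_compact.
apply: continuous_in_subspaceT => x; rewrite inE/= in_itv/= => xab.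
exact: cf.
Qed.

Lemma segment_integral_split a m b f : a <= m <= b ->
  continuous_on_segment a b f ->
  segment_integral a b f = segment_integral a m f + segment_integral m b f.
Proof.
move=> /andP[am mb] /continuous_on_segment_integrable fi.
rewrite /segment_integral; apply/eqP; rewrite addrC -subr_eq; apply/eqP.
rewrite Rintegral_itvB ?bnd_simp//.
rewrite Rintegral_itv_obnd_cbnd//.
by apply: integrableS fi => //; apply: subset_itvr; rewrite bnd_simp.
Qed.

(** Serves to compare opposite sides of a rectangle: [k] is the increment of the linear part of the
    integrand in [flux_small], and minus the real part of the derivative in [schwarz_Re]. *)
Lemma segment_integral_near_cst a b f g (k eta : R) : a <= b ->
  continuous_on_segment a b f -> continuous_on_segment a b g ->
  (forall x, a <= x <= b -> `|f x - g x - k| <= eta) ->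
  `|segment_integral a b f - segment_integral a b g - k * (b - a)|
    <= eta * (b - a).
Proof.
move=> ab cf cg H.
have fi := continuous_on_segment_integrable cf.
have gi := continuous_on_segment_integrable cg.
have cc r : continuous_on_segment a b (cst r) by move=> x _; exact: cst_continuous.
have ci r := continuous_on_segment_integrable (cc r).
have cstE r : segment_integral a b (cst r) = r * (b - a).
  rewrite /segment_integral Rintegral_cst//= lebesgue_measure_itv/= lte_fin.
  case: ltP => //= ba; have -> : b - a = 0 by lra.
  by rewrite mulr0.
have fgc : continuous_on_segment a b (fun x => f x - g x).
  by move=> x xab; apply: continuousB; [exact: cf|exact: cg].
have fgi := continuous_on_segment_integrable fgc.
rewrite -!cstE /segment_integral -RintegralB// -RintegralB//; last exact: ci.
have hc : continuous_on_segment a b (fun x => f x - g x - cst k x).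
  move=> x xab; apply: continuousB; last exact: cc.
  exact: fgc.
have hi := continuous_on_segment_integrable hc.
apply: (le_trans (le_normr_Rintegral _ _)) => //.
apply: le_Rintegral => //; last exact: ci.
by apply: continuous_on_segment_integrable => x xab;
     apply: (continuous_comp (hc x xab)); exact: norm_continuous.
Qed.

Implicit Types U V : R -> R -> R.

(** The imaginary part of the integral of [(U + i V) dz] around the rectangle, taken
    counterclockwise. *)
Definition flux U V a b c d : R :=
  segment_integral c d (U b) - segment_integral c d (U a)
  - (segment_integral a b (V^~ d) - segment_integral a b (V^~ c)).

(* Only one of the two Cauchy-Riemann equations, dU/ds = dV/dt (both equal to
   [al]), is needed to make the flux vanish. *)
Definition cr_at U V s0 t0 : Prop := exists al be ga : R,
  forall e : R, 0 < e -> exists2 dl : R, 0 < dl &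
  forall s t, `|s - s0| <= dl -> `|t - t0| <= dl ->
    `|U s t - U s0 t0 - (al * (s - s0) + be * (t - t0))|
       <= e * (`|s - s0| + `|t - t0|) /\
    `|V s t - V s0 t0 - (ga * (s - s0) + al * (t - t0))|
       <= e * (`|s - s0| + `|t - t0|).

Lemma cr_at_continuous U V s t : cr_at U V s t ->
  {for t, continuous (U s)} /\ {for s, continuous (V^~ t)}.
Proof.
move=> [al [be [ga H]]].
have aux (f : R -> R) (x k : R) : (forall e : R, 0 < e -> exists2 dl : R, 0 < dl &
    forall y, `|y - x| <= dl -> `|f y - f x - k * (y - x)| <= e * `|y - x|) ->
    {for x, continuous f}.
  move=> K; apply/cvgrPdist_le => e e0.
  have [dl dl0 Kd] := K 1 ltr01.
  pose q := 1 + `|k|.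
  have q0 : 0 < q by rewrite ltr_wpDr.
  near=> y.
  have xy : `|y - x| <= e / q.
    rewrite distrC; near: y.
    apply: (@cvgr_dist_le _ _ _ (nbhs x) _ id x cvg_id (e / q)).
    by rewrite divr_gt0.
  have xy' : `|y - x| <= dl.
    by rewrite distrC; near: y; exact: (@cvgr_dist_le _ _ _ (nbhs x) _ id x cvg_id).
  have {}Kd := Kd _ xy'.
  rewrite distrC.
  have -> : f y - f x = (f y - f x - k * (y - x)) + k * (y - x) by ring.
  apply: (le_trans (ler_normD _ _)); rewrite normrM.
  apply: (@le_trans _ _ (q * `|y - x|)).
    by rewrite /q mulrDl lerD.
  by rewrite mulrC -ler_pdivlMr.
split.
  apply: (aux _ _ be) => e /H[dl dl0 K]; exists dl => // y xy.
  have := (K s y); rewrite !subrr normr0 !mulr0 !add0r => /(_ (ltW dl0) xy)[+ _].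
  by [].
apply: (aux _ _ ga) => e /H[dl dl0 K]; exists dl => // y xy.
have := (K y t); rewrite !subrr normr0 !mulr0 !addr0 => /(_ xy (ltW dl0))[_ +].
by [].
Unshelve. all: by end_near. Qed.

Definition cr_on U V a b c d : Prop :=
  forall s t, a <= s <= b -> c <= t <= d -> cr_at U V s t.

Lemma cr_on_continuous U V a b c d : cr_on U V a b c d ->
  (forall s, a <= s <= b -> continuous_on_segment c d (U s)) /\
  (forall t, c <= t <= d -> continuous_on_segment a b (V^~ t)).
Proof.
by move=> H; split=> [s sab t tcd|t tcd s sab];
   have [] := cr_at_continuous (H s t sab tcd).
Qed.

Lemma flux_split U V a m b c n d : a <= m <= b -> c <= n <= d ->
  cr_on U V a b c d ->
  flux U V a b c d = flux U V a m c n + flux U V a m n d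
                   + (flux U V m b c n + flux U V m b n d).
Proof.
move=> amb cnd /cr_on_continuous[cU cV].
have /andP[am mb] := amb; have /andP[cn nd] := cnd.
have ab := le_trans am mb; have cd := le_trans cn nd.
have sU s : a <= s <= b -> segment_integral c d (U s) =
    segment_integral c n (U s) + segment_integral n d (U s).
  by move=> ?; apply: segment_integral_split => //; exact: cU.
have sV t : c <= t <= d -> segment_integral a b (V^~ t) =
    segment_integral a m (V^~ t) + segment_integral m b (V^~ t).
  by move=> ?; apply: segment_integral_split => //; exact: cV.
rewrite /flux !sU ?sV ?lexx ?ab ?cd ?amb ?cnd//.
ring.
Qed.


(** The linear parts contribute [al * h * k] to both differences of sides and cancel. The remainders
    are at most [e * (h + k)] on each side, hence [2 * e * (h + k) * k] for the vertical pair and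
    [2 * e * (h + k) * h] for the horizontal one. *)
Lemma flux_small U V s0 t0 : cr_at U V s0 t0 ->
  forall e : R, 0 < e -> exists2 dl : R, 0 < dl & forall a h c k,
    0 <= h -> 0 <= k -> a <= s0 <= a + h -> c <= t0 <= c + k ->
    cr_on U V a (a + h) c (c + k) -> h + k <= dl ->
    `|flux U V a (a + h) c (c + k)| <= 2 * e * (h + k) ^+ 2.
Proof.
move=> [al [be [ga H]]] e e0; have [dl dl0 {}H] := H e e0.
exists dl => // a h c k h0 k0 sah tck cr hkdl.
have [cU cV] := cr_on_continuous cr.
have sn s : a <= s <= a + h -> `|s - s0| <= h by rewrite ler_norml; lra.
have tn t : c <= t <= c + k -> `|t - t0| <= k by rewrite ler_norml; lra.
have ah : a <= a + h <= a + h by rewrite lerDl h0 lexx.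
have aa : a <= a <= a + h by rewrite lerDl h0 lexx.
have ck : c <= c + k <= c + k by rewrite lerDl k0 lexx.
have cc : c <= c <= c + k by rewrite lerDl k0 lexx.
have HU s t : a <= s <= a + h -> c <= t <= c + k ->
    `|U s t - U s0 t0 - (al * (s - s0) + be * (t - t0))| <= e * (h + k) /\
    `|V s t - V s0 t0 - (ga * (s - s0) + al * (t - t0))| <= e * (h + k).
  move=> sI tI; have sh := sn _ sI; have tk := tn _ tI.
  have [||H1 H2] := H s t; [lra|lra|].
  have E : e * (`|s - s0| + `|t - t0|) <= e * (h + k).
    by rewrite ler_pM2l// lerD.
  by split; [exact: le_trans H1 E|exact: le_trans H2 E].
have UI : `|segment_integral c (c + k) (U (a + h))
            - segment_integral c (c + k) (U a) - al * h * (c + k - c)|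
          <= 2 * e * (h + k) * (c + k - c).
  apply: segment_integral_near_cst => [||| t tI]; rewrite ?lerDl//.
  - exact: cU.
  - exact: cU.
  have [+ _] := HU _ _ ah tI; have [+ _] := HU _ _ aa tI.
  rewrite !ler_norml; lra.
have VI : `|segment_integral a (a + h) (V^~ (c + k))
            - segment_integral a (a + h) (V^~ c) - al * k * (a + h - a)|
          <= 2 * e * (h + k) * (a + h - a).
  apply: segment_integral_near_cst => [||| s sI]; rewrite ?lerDl//.
  - exact: cV.
  - exact: cV.
  have [_ +] := HU _ _ sI ck; have [_ +] := HU _ _ sI cc.
  rewrite !ler_norml; lra.
rewrite /flux; move: UI VI; rewrite !ler_norml.
move: (segment_integral _ _ _) (segment_integral _ _ _) (segment_integral _ _ _)
  (segment_integral _ _ _) => I1 I2 I3 I4.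
rewrite ![_ + _ - _]addrC !addKr.
nra.
Qed.

(** The fluxes of the four quarters add up to the whole flux, so they cannot all be smaller than a
    quarter of it. *)
Lemma flux_quarter U V a h c k : 0 <= h -> 0 <= k ->
  cr_on U V a (a + (h + h)) c (c + (k + k)) ->
  exists p : R * R, [/\ a <= p.1 <= a + h, c <= p.2 <= c + k &
    `|flux U V a (a + (h + h)) c (c + (k + k))|
      <= 4 * `|flux U V p.1 (p.1 + h) p.2 (p.2 + k)|].
Proof.
rewrite !addrA => h0 k0 cr; apply: contrapT => N.
have P x y : a <= x <= a + h -> c <= y <= c + k ->
    4 * `|flux U V x (x + h) y (y + k)|
      < `|flux U V a (a + h + h) c (c + k + k)|.
  move=> xI yI; rewrite ltNge; apply/negP => le4.
  by apply: N; exists (x, y).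
have aa : a <= a <= a + h by lra.
have aah : a <= a + h <= a + h by lra.
have cc : c <= c <= c + k by lra.
have cck : c <= c + k <= c + k by lra.
have := P _ _ aa cc; have := P _ _ aa cck.
have := P _ _ aah cc; have := P _ _ aah cck.
have xI : a <= a + h <= a + h + h by lra.
have yI : c <= c + k <= c + k + k by lra.
rewrite (flux_split xI yI cr).
set F1 := flux U V a _ c _; set F2 := flux U V a _ (c + k) _.
set F3 := flux U V (a + h) _ c _; set F4 := flux U V (a + h) _ (c + k) _.
have := ler_normD (F1 + F2) (F3 + F4); have := ler_normD F1 F2.
have := ler_normD F3 F4; lra.
Qed.

(** The supremum of the left ends works, since every right end is an upper bound of them. *)
Lemma nested_intervals (u l : nat -> R) :
  (forall n, 0 <= l n) -> (forall n, u n <= u n.+1) ->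
  (forall n, u n.+1 + l n.+1 <= u n + l n) ->
  exists x, forall n, u n <= x <= u n + l n.
Proof.
move=> l0 uS ulS.
have um m k : u m <= u (m + k)%N.
  by elim: k => [|k IH]; rewrite ?addn0// addnS (le_trans IH).
have ulm m k : u (m + k)%N + l (m + k)%N <= u m + l m.
  by elim: k => [|k IH]; rewrite ?addn0// addnS (le_trans _ IH).
have ub m : ubound (range u) (u m + l m).
  move=> _ [n _ <-]; have [mn|/ltnW nm] := leqP m n.
    rewrite -(subnKC mn); have := ulm m (n - m)%N; have := l0 (m + (n - m))%N; lra.
  rewrite -(subnKC nm); have := um n (m - n)%N; have := l0 (n + (m - n))%N; lra.
exists (sup (range u)) => n; apply/andP; split.
  by apply: ub_le_sup; [exists (u 0 + l 0); exact: ub|exists n].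
by apply: ge_sup; [exists (u 0); exists 0%N|exact: ub].
Qed.

(** Goursat's bisection: after [n] halvings the flux has lost at most a factor [4 ^+ n], while
    [flux_small] at the common point bounds the small flux by [2 * e'] times the square of
    [(h + k) / 2 ^+ n]; the powers of 2 cancel and [e'] is arbitrary. *)
Theorem flux_eq0 U V a h c k : 0 <= h -> 0 <= k ->
  cr_on U V a (a + h) c (c + k) -> flux U V a (a + h) c (c + k) = 0.
Proof.
move=> h0 k0 cr; apply/eqP; rewrite -normr_eq0 eq_le normr_ge0 andbT.
set F := `|_|.
pose hn n : R := h / 2 ^+ n; pose kn n : R := k / 2 ^+ n.
have hn0 n : 0 <= hn n by rewrite divr_ge0// exprn_ge0.
have kn0 n : 0 <= kn n by rewrite divr_ge0// exprn_ge0.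
have p2 n : (2 : R) ^+ n != 0 by rewrite expf_neq0.
have hnS n : hn n = hn n.+1 + hn n.+1 by rewrite /hn exprS; field.
have knS n : kn n = kn n.+1 + kn n.+1 by rewrite /kn exprS; field.
pose Q n (p : R * R) := [/\ a <= p.1, p.1 + hn n <= a + h, c <= p.2,
  p.2 + kn n <= c + k &
  F <= 4 ^+ n * `|flux U V p.1 (p.1 + hn n) p.2 (p.2 + kn n)|].
(* The premise [Q] stands inside the existential, so that choice yields a total function [G]. *)
have step (np : nat * (R * R)) : exists q : R * R, Q np.1 np.2 ->
    [/\ Q np.1.+1 q, np.2.1 <= q.1, q.1 + hn np.1.+1 <= np.2.1 + hn np.1,
     np.2.2 <= q.2 & q.2 + kn np.1.+1 <= np.2.2 + kn np.1].
  case: np => n [x y] /=.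
  have [[ax xh cy yk FQ]|N] := pselect (Q n (x, y)); last by exists (x, y).
  simpl in ax, xh, cy, yk, FQ.
  have [s t /=|[x' y'] /= [xx' yy' F4]] :=
    @flux_quarter U V x (hn n.+1) y (kn n.+1) (hn0 _) (kn0 _).
    rewrite -hnS -knS => /andP[sx sh] /andP[ty tk].
    by apply: cr; apply/andP; split; lra.
  have hS := hnS n; have kS := knS n.
  exists (x', y') => _ /=; split; try lra.
  split => /=; try lra.
  apply: (le_trans FQ).
  by rewrite hS kS exprS (mulrC 4) -mulrA ler_pM2l ?exprn_gt0.
have [G HG] := choice step.
pose p := fix p n := if n is m.+1 then G (m, p m) else (a, c).
have Qp n : Q n (p n).
  elim: n => [|n IH]; last by have [] := HG (n, p n) IH.
  rewrite /Q /= /hn /kn !expr0 !divr1 mul1r; split => //; exact: lexx.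
have [s0 Hs] := @nested_intervals (fun n => (p n).1) hn hn0
  (fun n => let: And5 _ H _ _ _ := HG (n, p n) (Qp n) in H)
  (fun n => let: And5 _ _ H _ _ := HG (n, p n) (Qp n) in H).
have [t0 Ht] := @nested_intervals (fun n => (p n).2) kn kn0
  (fun n => let: And5 _ _ _ H _ := HG (n, p n) (Qp n) in H)
  (fun n => let: And5 _ _ _ _ H := HG (n, p n) (Qp n) in H).
have crst : cr_at U V s0 t0.
  apply: cr; have [] := Hs 0%N; have [] := Ht 0%N;
    by rewrite /hn /kn /= !expr0 !divr1.
apply/ler_addgt0Pr => e e0; rewrite add0r.
(* The summand 1 keeps the denominator positive for a degenerate rectangle. *)
pose e' := e / (2 * (h + k + 1) ^+ 2).
have q0 : 0 < (h + k + 1) ^+ 2 by rewrite exprn_gt0//; lra.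
have e'0 : 0 < e' by rewrite divr_gt0// mulr_gt0.
have [dl dl0 HF] := flux_small crst e'0.
have [n Hn] : exists n, hn n + kn n <= dl.
  have [n Hn] : exists n : nat, (h + k) / dl <= n%:R.
    by exists (Num.bound ((h + k) / dl)); apply/ltW/archi_boundP; rewrite divr_ge0 ?addr_ge0// ltW.
  exists n; rewrite /hn /kn -mulrDl ler_pdivrMr ?exprn_gt0//.
  move: Hn; rewrite ler_pdivrMr// mulrC => /le_trans; apply.
  rewrite ler_pM2l// -natrX ler_nat; exact/ltnW/ltn_expl.
have [ax xh cy yk FQ] := Qp n.
have crn : cr_on U V (p n).1 ((p n).1 + hn n) (p n).2 ((p n).2 + kn n).
  by move=> s t sI tI; apply: cr; lra.
have := HF _ _ _ _ (hn0 n) (kn0 n) (Hs n) (Ht n) crn Hn.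
have p4 : 0 < (4 : R) ^+ n by rewrite exprn_gt0.
rewrite -(ler_pM2l p4) => /(le_trans FQ) /le_trans; apply.
have -> : (4 : R) ^+ n * (2 * e' * (hn n + kn n) ^+ 2) = 2 * e' * (h + k) ^+ 2.
  have -> : (4 : R) ^+ n = 2 ^+ n ^+ 2 by rewrite exprAC; congr (_ ^+ _); ring.
  by rewrite /hn /kn; field.
have -> : e = 2 * e' * (h + k + 1) ^+ 2.
  by rewrite /e'; field; rewrite gt_eqF//; lra.
apply: ler_wpM2l; first by apply: mulr_ge0 => //; exact: ltW.
rewrite -subr_ge0.
have -> : (h + k + 1) ^+ 2 - (h + k) ^+ 2 = 2 * (h + k) + 1 by ring.
lra.
Qed.

End Goursat.

(** * Schwarz's lemma *)

(** Multiplying the difference quotient by [h] removes the exception at [h = 0]; restriction to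
    lines, translation and rescaling then reduce to rewriting the argument of [f]. *)
Lemma is_deriveP (K : numFieldType) (V W : normedModType K) (f : V -> W)
    (a v : V) (d : W) :
  is_derive a v f d <->
  (forall e : K, 0 < e -> exists2 dl : K, 0 < dl & forall h : K, `|h| < dl ->
     `|f (h *: v + a) - f a - h *: d| <= e * `|h|).
Proof.
have quo (d' : W) (h : K) (x : W) : h != 0 -> `|d' - h^-1 *: x| = `|h|^-1 * `|x - h *: d'|.
  move=> h0; rewrite -normfV -normrZ scalerBr scalerA mulVf// scale1r.
  exact: distrC.
split=> [[df <-] e e0|H].
- move: df => /= /cvgrPdist_le /(_ e e0); rewrite -[lim _]/('D_v f a) => [].
  case=> /= dl dl0 B; exists dl => // h hdl.
  have [->|h0] := eqVneq h 0; first by rewrite !scale0r add0r subrr subr0 !normr0 mulr0.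
  have : `|'D_v f a - h^-1 *: (f (h *: v + a) - f a)| <= e.
    by apply: B => //=; rewrite sub0r normrN.
  by rewrite quo// ler_pdivrMl ?normr_gt0// mulrC.
have C : h^-1 *: (f (h *: v + a) - f a) @[h --> 0^'] --> d.
  apply/cvgrPdist_le => e e0; have [dl dl0 B] := H e e0.
  exists dl => // h; rewrite /ball_ /= sub0r normrN => hdl h0.
  by rewrite quo// ler_pdivrMl ?normr_gt0// mulrC; exact: B.
by apply: DeriveDef; [apply/cvg_ex; exists d|exact: cvg_lim C].
Qed.

Section ComplexExponential.
Context {R : realType}.
Local Notation C := (Cplx R).

Lemma CscaleE (a b : C) : a *: b = a * b.
Proof. by []. Qed.

Lemma normCE (z : C) : `|z| = (Num.sqrt (complex.Re z ^+ 2 + complex.Im z ^+ 2))%:C.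
Proof. exact: normc_def. Qed.

Definition cexp (z : C) : C :=
  (expR (complex.Re z) * cos (complex.Im z))
  +i* (expR (complex.Re z) * sin (complex.Im z)).

Lemma norm_cexp z : `|cexp z| = (expR (complex.Re z))%:C.
Proof.
rewrite normCE/= !exprMn -mulrDr cos2Dsin2 mulr1 sqrtr_sqr ger0_norm//.
Qed.

Lemma cexp_neq0 z : cexp z != 0.
Proof. 
rewrite -normr_eq0 norm_cexp; apply/eqP => -[/eqP]. by rewrite gt_eqF ?expR_gt0.
Qed.

Lemma cexpD z z' : cexp (z + z') = cexp z * cexp z'.
Proof.
case: z z' => [a b] [a' b']; rewrite /cexp /= expRD cosD sinD.
apply/eqP; rewrite eq_complex; apply/andP; split; apply/eqP => /=; ring.
Qed.

Lemma cexp_periodic (s t : R) : cexp (s +i* (t + pi *+ 2)) = cexp (s +i* t).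
Proof. by rewrite /cexp /= cosD sinD cos2pi sin2pi !mulr1 !mulr0 subr0 addr0. Qed.

Lemma normC_Re_Im (z : C) : `|z| <= (`|complex.Re z| + `|complex.Im z|)%:C.
Proof.
case: z => x y; rewrite normCE lecR /=.
have -> : `|x| + `|y| = Num.sqrt ((`|x| + `|y|) ^+ 2).
  by rewrite sqrtr_sqr [`|_ + _|]ger0_norm// addr_ge0.
apply: ler_wsqrtr.
rewrite sqrrD !real_normK ?num_real// -addrA lerD2l lerDr.
by rewrite mulrn_wge0// mulr_ge0.
Qed.

Lemma norm_Re_le (z : C) : (`|complex.Re z|)%:C <= `|z|.
Proof. by have := normc_ge_Re z. Qed.

Lemma norm_Im_le (z : C) : (`|complex.Im z|)%:C <= `|z|.
Proof.
case: z => x y; rewrite normCE lecR /= -sqrtr_sqr; apply: ler_wsqrtr.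
by rewrite lerDr sqr_ge0.
Qed.

Lemma gt0_real (e : C) : 0 < e -> exists2 r : R, 0 < r & e = r%:C.
Proof.
case: e => [a b]; rewrite ltcE/= => /andP[/eqP b0 a0].
by exists a => //; apply/eqP; rewrite eq_complex/= b0 !eqxx.
Qed.

Lemma normC_lt_Re_Im (z : C) (r : R) : `|z| < r%:C ->
  `|complex.Re z| < r /\ `|complex.Im z| < r.
Proof.
by move=> zr; split; rewrite -ltcR; apply: le_lt_trans zr;
   [exact: norm_Re_le|exact: norm_Im_le].
Qed.

Lemma is_derive_cexp0 : is_derive (0 : C) 1 cexp 1.
Proof.
apply/is_deriveP => _ /gt0_real[r r0 ->].
(* The bounds on the real and imaginary parts below add up to [e * |x| + 8 * e * |y|], at most
   [9 * e] times the modulus of [x + i y]; 18 leaves a factor 2 to spare. *)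
have [e [e0 e1 er]] : exists e : R, [/\ 0 < e, e <= 1 & e <= r / 18].
  exists (Num.min 1 (r / 18)).
  by rewrite lt_min ltr01 divr_gt0// !ge_min !lexx orbT.
have [d1 d10 H1] := (is_deriveP _ _ _ _).1 (is_derive_expR (0 : R)) e e0.
have [d2 d20 H2] := (is_deriveP _ _ _ _).1 (is_derive_cos (0 : R)) e e0.
have [d3 d30 H3] := (is_deriveP _ _ _ _).1 (is_derive_sin (0 : R)) e e0.
pose dl := Num.min e (Num.min d1 (Num.min d2 d3)).
exists dl%:C; first by rewrite ltcR !lt_min e0 d10 d20 d30.
move=> h hdl; have [] := normC_lt_Re_Im hdl.
have := norm_Re_le h; have := norm_Im_le h; rewrite normCE.
case: h {hdl} => x y /=; set N := Num.sqrt _; rewrite !lecR => yN xN.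
rewrite !lt_min => /and4P[xe x1 _ _] /and4P[_ _ y2 y3].
have {}H1 : `|expR x - 1 - x| <= e * `|x|.
  by have := H1 _ x1; rewrite addr0 expR0 [_%:A]mulr1.
have {}H2 : `|cos y - 1| <= e * `|y|.
  by have := H2 _ y2; rewrite addr0 sin0 cos0 oppr0 scaler0 subr0 [_%:A]mulr1.
have {}H3 : `|sin y - y| <= e * `|y|.
  by have := H3 _ y3; rewrite addr0 sin0 cos0 subr0 [_%:A]mulr1.
have xe' := ltW xe.
rewrite addr0 /cexp /= expR0 sin0 cos0 !(mulr1, mulr0, add0r, subr0).
apply: (le_trans (normC_Re_Im _)); rewrite -rmorphM lecR /=. rewrite !(mulr1, mulr0, add0r, subr0).
move: H1 H2 H3; set A := expR x - 1 - x; set B := cos y - 1.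
set D := sin y - y => HA HB HD.
have EA : `|1 + x + A| <= 3.
  have := ler_normD (1 + x) A; have := ler_normD 1 x; rewrite normr1.
  have : e * `|x| <= 1 * 1 by apply: ler_pM => //; [exact: ltW|lra].
  lra.
have -> : expR x * cos y - 1 - x = A + (1 + x + A) * B.
  by rewrite /A /B; ring.
have -> : expR x * sin y - y = (x + A) * y + (1 + x + A) * D.
  by rewrite /A /D; ring.
have F1 : `|A + (1 + x + A) * B| <= e * `|x| + 3 * (e * `|y|).
  by apply: (le_trans (ler_normD _ _)); rewrite lerD// normrM ler_pM.
have F2 : `|(x + A) * y + (1 + x + A) * D| <= 2 * e * `|y| + 3 * (e * `|y|).
  apply: (le_trans (ler_normD _ _)); rewrite lerD// normrM ler_pM//.
  have := ler_normD x A.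
  have : e * `|x| <= 1 * e by apply: ler_pM => //; exact: ltW.
  lra.
apply: (le_trans (lerD F1 F2)).
have xr : e * `|x| <= r / 18 * N by apply: ler_pM => //; exact: ltW.
have yr : e * `|y| <= r / 18 * N by apply: ler_pM => //; exact: ltW.
have rN : 0 <= r * N by rewrite mulr_ge0 ?sqrtr_ge0// ltW.
lra.
Qed.



Lemma is_derive_cexp (z : C) : is_derive z 1 cexp (cexp z).
Proof.
apply/is_deriveP => e e0.
have cz : 0 < `|cexp z| by rewrite normr_gt0 cexp_neq0.
have [dl dl0 H] := (is_deriveP _ _ _ _).1 is_derive_cexp0 (e / `|cexp z|)
  (divr_gt0 e0 cz).
exists dl => // h /H; rewrite !addr0.
have -> : cexp (h%:A + z) - cexp z - h *: cexp z
    = (cexp h%:A - 1 - h%:A) * cexp z.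
  by rewrite cexpD CscaleE mulr1 CscaleE !mulrBl mul1r.
have -> : cexp (0 : C) = 1.
  by rewrite /cexp /= expR0 cos0 sin0 mulr1 mulr0.
by rewrite normrM -ler_pdivlMr// mulrAC.
Qed.

Lemma cr_at_holomorphic (F : C -> C) (s0 t0 : R) :
  derivable F (s0 +i* t0) 1 ->
  cr_at (fun s t => complex.Re (F (s +i* t)))
        (fun s t => complex.Im (F (s +i* t))) s0 t0.
Proof.
move=> /derivableP; set d : C := 'D_1 F _ => /is_deriveP H.
exists (complex.Re d), (- complex.Im d), (complex.Im d) => e e0.
have [|_ /gt0_real[dl dl0 ->] {}H] := H (e%:C); first by rewrite ltcR.
exists (dl / 3); first by rewrite divr_gt0.
move=> s t sdl tdl.
pose h : C := (s - s0) +i* (t - t0).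
have hn : `|h| <= (`|s - s0| + `|t - t0|)%:C by exact: normC_Re_Im.
have hdl : `|h| < dl%:C by apply: le_lt_trans hn _; rewrite ltcR; lra.
have {H} := H h hdl.
have -> : h%:A + s0 +i* t0 = s +i* t.
  rewrite CscaleE mulr1; apply/eqP; rewrite eq_complex /= !subrK !eqxx//.
set Fz := F _; set F0 := F _ => H.
have {}H : `|Fz - F0 - h *: d| <= (e * (`|s - s0| + `|t - t0|))%:C.
  by apply: (le_trans H); rewrite rmorphM ler_pM2l// ltcR.
split; rewrite -lecR; apply: le_trans H.
  apply: le_trans (norm_Re_le _); rewrite lecR le_eqVlt; apply/orP; left.
  apply/eqP; congr `|_|; rewrite CscaleE /h.
  by case: Fz F0 d => [? ?] [? ?] [? ?] /=; ring.
apply: le_trans (norm_Im_le _); rewrite lecR le_eqVlt; apply/orP; left.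
apply/eqP; congr `|_|; rewrite CscaleE /h.
by case: Fz F0 d => [? ?] [? ?] [? ?] /=; ring.
Qed.

(* Schwarz's lemma: Goursat's theorem applied to f(exp z) / exp z, which has
   period 2 pi i, on the rectangles [a, b] x [0, 2 pi] with b < 0, shows that
   the mean of f(z) / z over a circle |z| = exp b equals its limit f'(0) as
   the radius tends to 0. *)
Lemma schwarz_Re (f : C -> C) (d : C) (M : R) :
  (forall z : C, `|z| < 1 -> derivable f z 1) -> f 0 = 0 ->
  is_derive (0 : C) 1 f d -> (forall z : C, `|z| < 1 -> `|f z| <= M%:C) ->
  `|complex.Re d| <= M.
Proof.
move=> df f0 /is_deriveP f'0 fM.
have M0 : 0 <= M.
  by rewrite -lecR; apply: le_trans (normr_ge0 (f 0)) (fM 0 _); rewrite normr0 ltr01.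
pose F (z : C) : C := f (cexp z) / cexp z.
have FD z : complex.Re z < 0 -> derivable F z 1.
  move=> z0; apply: derivableM.
    apply/derivable1_diffP; apply: differentiable_comp.
      by apply/derivable1_diffP; have [] := is_derive_cexp z.
    by apply/derivable1_diffP/df; rewrite norm_cexp ltcR expR_lt1.
  by apply: derivableV; [exact: cexp_neq0|have [] := is_derive_cexp z].
have key (r e : R) : 0 < r -> r < 1 -> 0 < e -> `|complex.Re d| <= M / r + e.
  move=> r0 r1 e0; have [b rE] := expR_total r0.
  have b0 : b < 0 by rewrite -expR_lt1 rE.
  have [|_ /gt0_real[dl dl0 ->] H] := f'0 e%:C; first by rewrite ltcR.
  (* The inner circle must lie inside the one of radius [r] and where [f z / z] is within [e] of
     [d]. *)
  have [a [ab aE]] : exists a : R, a < b /\ expR a < dl.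
    have [|a' aE] := @expR_total R (Num.min dl r / 2).
      by rewrite divr_gt0// lt_min dl0 r0.
    have m0 : 0 < Num.min dl r by rewrite lt_min dl0 r0.
    have mr : Num.min dl r <= r by rewrite ge_min lexx orbT.
    have md : Num.min dl r <= dl by rewrite ge_min lexx.
    exists a'; rewrite -ltr_expR rE aE; split; lra.
  pose U s t := complex.Re (F (s +i* t)); pose V s t := complex.Im (F (s +i* t)).
  have h0 : 0 <= b - a by rewrite subr_ge0 ltW.
  have p0 : 0 < pi *+ 2 :> R by rewrite mulrn_wgt0// pi_gt0.
  have cr : cr_on U V a (a + (b - a)) 0 (0 + pi *+ 2).
    move=> s t /andP[_ sb] _; apply: cr_at_holomorphic; apply: FD => /=.
    by apply: le_lt_trans b0; rewrite addrC subrK in sb.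
  have [cU _] := cr_on_continuous cr.
  have := flux_eq0 h0 (ltW p0) cr; rewrite /flux.
  (* By periodicity the horizontal sides cancel, and the vanishing flux equates the integrals of [U]
     on the two vertical sides, that is, the means of the real part of [f z / z] over the two
     circles. *)
  have -> : V^~ (0 + pi *+ 2) = V^~ 0.
    by apply/funext => s; rewrite /V /F !cexp_periodic.
  have bE : a + (b - a) = b by rewrite addrC subrK.
  rewrite bE in cU *; rewrite [X in _ - X]subrr subr0 => I0.
  have Ub t : `|U b t| <= M / r.
    rewrite -lecR; apply: (le_trans (norm_Re_le _)).
    rewrite /F normf_div norm_cexp /= rE rmorphM fmorphV /=.
    rewrite ler_pM2r ?invr_gt0 ?ltcR//; apply: fM.
    by rewrite norm_cexp ltcR /= rE.
  have Ua t : `|U a t - complex.Re d| <= e.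
    pose z := cexp (a +i* t).
    have nz : `|z| = (expR a)%:C by rewrite norm_cexp.
    have z0 : z != 0 by exact: cexp_neq0.
    have := H z; rewrite nz ltcR => /(_ aE).
    rewrite f0 addr0 subr0 !CscaleE mulr1 => Hz.
    have K : `|f z / z - d| <= e%:C.
      have -> : f z / z - d = (f z - z * d) / z by field.
      by rewrite normf_div ler_pdivrMr ?normr_gt0// nz.
    rewrite -lecR; apply: le_trans K; apply: le_trans (norm_Re_le _).
    by rewrite /U /F -/z; case: (f z / z) => ? ?; case: (d).
  have := @segment_integral_near_cst R 0 (0 + pi *+ 2) (U b) (U a)
    (- complex.Re d) (M / r + e).
  rewrite I0 sub0r mulNr !opprK !add0r subr0 normrM.
  rewrite add0r in cU.
  rewrite [`|pi *+ 2|]gtr0_norm// ler_pM2r//.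
  have ab' := ltW ab.
  apply; [exact: ltW|apply: cU|apply: cU|move=> t _]; rewrite ?ab' ?lexx//.
  have -> : U b t - U a t + complex.Re d = U b t - (U a t - complex.Re d).
    by rewrite opprB addrA addrAC.
  apply: (le_trans (ler_normB _ _)).
  by apply: lerD; [exact: Ub|exact: Ua].
set q := `|_|.
have q0 : 0 <= q := normr_ge0 _.
apply/ler_addgt0Pr => e e0.
(* The outer radius [1 - eta] tends to 1. Multiplying [q <= M / (1 - eta) + e / 2] by it costs
   [eta * q], which takes up the other half of [e]. *)
have [eta [eta0 eta1 etaq]] : exists eta : R, [/\ 0 < eta, eta < 1 & eta * q <= e / 2].
  exists (Num.min 2^-1 (e / 2 / (q + 1))); have q1 : 0 < q + 1 by lra.
  split; first by rewrite lt_min invr_gt0 ltr0n !divr_gt0.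
    by rewrite gt_min; apply/orP; left; lra.
  apply: (@le_trans _ _ (e / 2 / (q + 1) * q)).
    by rewrite ler_wpM2r// ge_min lexx orbT.
  rewrite -mulrA ler_piMr//; first by lra.
  by rewrite mulrC ler_pdivrMr//; lra.
have r0 : 0 < 1 - eta by lra.
have := key (1 - eta) (e / 2) r0 ltac:(lra) ltac:(lra); rewrite -/q.
rewrite -(ler_pM2r r0) mulrDl -mulrA mulVf ?gt_eqF// mulr1 mulrBr mulr1.
have : 0 < e * eta by rewrite mulr_gt0.
lra.
Qed.

End ComplexExponential.

(** * Holomorphic maps into a Hilbert space *)

(** Nonnegativity of the square of [u - k *: v], the part of [u] orthogonal to [v]. No norm is
    involved, so that it applies to [dotmx] on row vectors as well as to [H]. *)
Lemma dot_CauchySchwarz (K : numClosedFieldType) (U : lmodType K)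
    (dot : {dot U for Num.conj}) (u v : U) :
  `|dot u v| ^+ 2 <= dot u u * dot v v.
Proof.
have [->|v0] := eqVneq v 0.
  by rewrite !linear0r normr0 expr0n.
have vv : 0 < dot v v by rewrite (dnorm_gt0 dot).
pose k := dot u v / dot v v.
have := dnorm_ge0 dot (u - k *: v).
rewrite (dnormB dot) (dnormZ dot) linearZr_LR /=.
have kE : Num.conj k * dot u v = `|dot u v| ^+ 2 / dot v v.
  by rewrite /k rmorphM fmorphV /= (geC0_conj (ltW vv)) normCK; ring.
have -> : `|k| ^+ 2 * dot v v = `|dot u v| ^+ 2 / dot v v.
  rewrite /k normf_div (gtr0_norm vv) expr_div_n; field.
  by rewrite gt_eqF.
rewrite kE rmorphM fmorphV /= (geC0_conj (ltW vv)) rmorphXn /=.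
rewrite (geC0_conj (normr_ge0 _)) opprD addrA addrK subr_ge0.
by rewrite ler_pdivrMr.
Qed.

Section BanachHolomorphic.
Context {R : realType}.
Local Notation C := (Cplx R).

Lemma is_derive_line (V W : normedModType C) (F : V -> W) (z v : V) (t : C) d :
  is_derive (t *: v + z) v F d <-> is_derive t 1 (fun s => F (s *: v + z)) d.
Proof.
by split=> /is_deriveP H; apply/is_deriveP => e /H[dl dl0 K]; exists dl => // h /K;
   rewrite CscaleE mulr1 scalerDl addrA.
Qed.

Lemma is_derive_Re (f : C -> C) (t : R) (d : C) :
  is_derive (t%:C : C) 1 f d ->
  is_derive t 1 (fun s : R => complex.Re (f s%:C)) (complex.Re d).
Proof.
move=> /is_deriveP H; apply/is_deriveP => e e0.
have [|_ /gt0_real[dl dl0 ->] K] := H e%:C; first by rewrite ltcR.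
exists dl => // h hdl; have := K h%:C.
rewrite normCE /= expr0n addr0 sqrtr_sqr ltcR => /(_ hdl).
rewrite !CscaleE !mulr1 -rmorphD -rmorphM => E.
rewrite -lecR; apply: le_trans E; apply: le_trans (norm_Re_le _).
rewrite lecR [h%:A]mulr1 [h *: _]/(h * _).
by case: (f _) (f _) (d) => [? ?] [? ?] [? ?] /=; rewrite mul0r subr0.
Qed.

Context (H : completeNormedModType C) (dot : {dot H for Num.conj}).
Hypothesis hH : is_hilbert dot.

Lemma norm_dot (u v : H) : `|dot u v| <= `|u| * `|v|.
Proof.
rewrite -ler_sqr ?nnegrE ?mulr_ge0// exprMn -!hH.
exact: dot_CauchySchwarz.
Qed.

Lemma is_derive_dotl (V : normedModType C) (f : V -> H) (a v : V) d c :
  is_derive a v f d -> is_derive a v (fun z => dot (f z) c) (dot d c).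
Proof.
move=> /is_deriveP Hf; apply/is_deriveP => e e0.
have c1 : 0 < `|c| + 1 by rewrite ltr_wpDl.
have [dl dl0 K] := Hf (e / (`|c| + 1)) (divr_gt0 e0 c1).
exists dl => // h /K E.
rewrite CscaleE -linearZl_LR -!(linearBl dot).
apply: (le_trans (norm_dot _ _)).
apply: (@le_trans _ _ (e / (`|c| + 1) * `|h| * (`|c| + 1))).
  by apply: ler_pM => //; rewrite lerDl.
by rewrite mulrAC divfK ?gt_eqF.
Qed.

(** Schwarz's lemma for the scalar function [dot (f (r * z) - f 0) d] on the unit disc: its
    derivative at 0 is [r * |d|^2], and it is bounded by [2 * M * |d|], the factor 2 coming from the
    subtraction of [f 0]. *)
Lemma cauchy_estimate (f : C -> H) (r M : C) d : 0 < r ->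
  (forall z, `|z| < r -> derivable f z 1) -> is_derive (0 : C) 1 f d ->
  (forall z, `|z| < r -> `|f z| <= M) -> `|d| * r <= 2 * M.
Proof.
move=> r0 df f'0 fM.
have M0 : 0 <= M by apply: le_trans (fM 0 _); rewrite ?normr0.
have [->|d0] := eqVneq d 0; first by rewrite normr0 mul0r mulr_ge0.
have dn0 : 0 < `|d| by rewrite normr_gt0.
pose g (z : C) : C := dot (f (r * z) - f 0) d.
have rz z : `|z| < 1 -> `|r * z| < r.
  by move=> z1; rewrite normrM gtr0_norm// gtr_pMr.
have gd (z : C) d' : is_derive (r * z) 1 f d' ->
    is_derive z 1 g (dot (r *: d') d).
  move=> fd; apply: (@is_derive_dotl C (fun z => f (r * z) - f 0)).
  apply/is_deriveP => e e0; have [dl dl0 K] := (is_deriveP _ _ _ _).1 fd _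
    (divr_gt0 e0 r0).
  exists (dl / r); first by rewrite divr_gt0.
  move=> h; rewrite ltr_pdivlMr// => hr.
  have rh : `|r * h| = `|h| * r by rewrite normrM (gtr0_norm r0) mulrC.
  have := K (r * h); rewrite rh => /(_ hr).
  rewrite !CscaleE !mulr1 mulrDr opprB addrA subrK scalerA [h * r]mulrC.
  move=> /le_trans; apply.
  by rewrite mulrCA divfK ?gt_eqF// mulrC.
pose m := complex.Re (2 * M * `|d|).
have mE : m%:C = 2 * M * `|d|.
  by apply: RRe_real; rewrite ger0_real// !mulr_ge0.
have := @schwarz_Re R g (dot (r *: d) d) m.
move=> /(_ _ _ _ _)/wrap[].
- by move=> z z1; have /derivableP/gd[] := df _ (rz _ z1).
- by rewrite /g mulr0 subrr linear0l.
- by apply: gd; rewrite mulr0.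
- move=> z z1; rewrite mE; apply: (le_trans (norm_dot _ _)).
  rewrite ler_pM2r//; apply: (le_trans (ler_normB _ _)).
  by rewrite mulr2n mulrDl !mul1r lerD// fM// ?normr0// rz.
rewrite -lecR mE linearZl_LR /= hH => /(le_trans _) K.
rewrite -(ler_pM2r dn0); apply: K.
have -> : `|d| * r * `|d| = r * `|d| ^+ 2 by ring.
set X := r * _.
have X0 : 0 <= X by rewrite mulr_ge0 ?exprn_ge0// ltW.
by rewrite -{1}(RRe_real (ger0_real X0)) lecR ler_norm.
Qed.

(** Pairing with the increment [u] itself reduces to the real mean value theorem: [|u|^2] is the
    real part of [dot ('D_h F) u] at an intermediate point, hence at most [B * |u|]. *)
Lemma mean_value_bound (V : normedModType C) (F : V -> H) (z h : V) (B : C) :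
  (forall t : R, 0 <= t <= 1 -> derivable F (t%:C *: h + z) h) ->
  (forall t : R, 0 <= t <= 1 -> `|'D_h F (t%:C *: h + z)| <= B) ->
  `|F (h + z) - F z| <= B.
Proof.
move=> dF FB; set u := _ - _.
have [u0|u0] := eqVneq u 0.
  by rewrite u0 normr0; apply: le_trans (FB 0 _); rewrite ?lexx ?ler01.
pose g (t : C) : C := dot (F (t *: h + z)) u.
pose dg (t : R) : R := complex.Re (dot ('D_h F (t%:C *: h + z)) u).
have gd (t : R) : 0 <= t <= 1 ->
    is_derive t 1 (fun s : R => complex.Re (g s%:C)) (dg t).
  move=> tI; apply: is_derive_Re.
  apply: (@is_derive_dotl C (fun s => F (s *: h + z))).
  by apply/is_derive_line/derivableP/dF.
have [|||c] := @MVT_segment R (fun s : R => complex.Re (g s%:C)) dg 0 1.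
- exact: ler01.
- by move=> t /[!in_itv]/= /andP[t0 t1]; apply: gd; rewrite !ltW.
- apply: derivable_within_continuous => t /[!in_itv]/= tI.
  by have [] := gd t tI.
rewrite in_itv /= => cI; rewrite subr0 mulr1 /g scale1r scale0r add0r.
set x := dot _ _; set y := dot _ _ => E.
have xy : x - y = `|u| ^+ 2 by rewrite -hH /x /y -(linearBl dot).
have {E} E : complex.Re (`|u| ^+ 2) = dg c.
  by rewrite -xy -E; case: (x) (y) => [? ?] [? ?].
have un : 0 < `|u| by rewrite normr_gt0.
rewrite -(ler_pM2r un) -expr2 -(RRe_real (ger0_real (exprn_ge0 2 (ltW un)))).
rewrite E; apply: (@le_trans _ _ (`|dg c|)%:C); first by rewrite lecR ler_norm.
apply: (le_trans (norm_Re_le _)); apply: (le_trans (norm_dot _ _)).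
by rewrite ler_pM2r// FB.
Qed.

Lemma is_derive_translate (V : normedModType C) (F : V -> H) (z h v : V) d :
  is_derive (h + z) v F d <-> is_derive z v (fun x => F (h + x)) d.
Proof.
by split=> /is_deriveP K; apply/is_deriveP => e /K[dl dl0 {}K]; exists dl => // k /K;
   rewrite addrCA.
Qed.

(** The one-variable estimate on the complex line through [z] in the direction [v], where the ball
    of radius [rho] is a disc of radius [rho / |v|]. *)
Lemma cauchy_estimate_dir (V : normedModType C) (G : V -> H) (z v : V) (rho N : C) : 0 < rho ->
  (forall x, `|x - z| < rho -> differentiable G x) ->
  (forall x, `|x - z| < rho -> `|G x| <= N) ->
  `|'D_v G z| * rho <= 2 * N * `|v|.
Proof.
move=> rho0 dG GN.
have zz : `|z - z| < rho by rewrite subrr normr0.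
have [->|v0] := eqVneq v 0.
  by rewrite derive0 !normr0 mul0r mulr0.
have vn : 0 < `|v| by rewrite normr_gt0.
have K (t : C) : `|t| < rho / `|v| -> `|t *: v + z - z| < rho.
  by move=> tr; rewrite addrK normrZ -ltr_pdivlMr.
have := @cauchy_estimate (fun t => G (t *: v + z)) (rho / `|v|) N ('D_v G z).
rewrite mulrA ler_pdivrMr//; apply; first by rewrite divr_gt0.
- move=> t /K tr; have /(@diff_derivable _ _ _ _ _ v)/derivableP := dG _ tr.
  by move=> /is_derive_line[].
- apply/is_derive_line; rewrite scale0r add0r.
  by apply/derivableP/diff_derivable/dG.
- by move=> t /K; exact: GN.
Qed.

(** * Quantitative estimates near a point, on balls of radius 4r, 3r, 2r and r *)

Section Ball.
Context (V : normedModType C) (F : V -> H) (z0 : V) (r M : C).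
Hypothesis r0 : 0 < r.
Hypothesis dF : forall z, `|z - z0| < 4 * r -> differentiable F z.
Hypothesis FM : forall z, `|z - z0| < 4 * r -> `|F z| <= M.

Lemma ltr_dist_split (x y z : V) (a b : C) :
  `|x| < a -> `|y - z| < b -> `|x + y - z| < a + b.
Proof.
by move=> xa yb; rewrite -addrA; apply: le_lt_trans (ler_normD _ _) (ltrD xa yb).
Qed.

Let dF' z v : `|z - z0| < 4 * r -> derivable F z v.
Proof. by move=> /dF /diff_derivable. Qed.

Lemma derive_bound z v : `|z - z0| < 3 * r -> `|'D_v F z| * r <= 2 * M * `|v|.
Proof.
move=> zr; have E (x : V) : `|x - z| < r -> `|x - z0| < 4 * r.
  move=> xz; rewrite -(subrK z x) (_ : 4 * r = r + 3 * r); last by ring.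
  exact: ltr_dist_split.
by apply: cauchy_estimate_dir => // x /E; [exact: dF|exact: FM].
Qed.

Lemma norm_scale_lt (t : R) (h : V) : 0 <= t <= 1 -> `|h| < r -> `|t%:C *: h| < r.
Proof.
move=> /andP[t0 t1]; apply: le_lt_trans; rewrite normrZ ger0_norm ?ler0c//.
by rewrite ler_piMl// lecR.
Qed.

Lemma increment_bound z h : `|z - z0| < 2 * r -> `|h| < r ->
  `|F (h + z) - F z| <= 2 * M * `|h| / r.
Proof.
move=> zr hr.
have E (t : R) : 0 <= t <= 1 -> `|t%:C *: h + z - z0| < 3 * r.
  move=> tI; rewrite (_ : 3 * r = r + 2 * r); last by ring.
  by apply: ltr_dist_split => //; exact: norm_scale_lt.
apply: mean_value_bound => t /E tr.
  apply: dF'; apply: lt_trans tr _.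
  by rewrite ltr_pM2r// ltr_nat.
by rewrite ler_pdivlMr//; exact: derive_bound.
Qed.

(** Cauchy's estimate for the increment [F (h + x) - F x] as a function of [x]: [increment_bound]
    makes it of order [|h|] on a whole ball. *)
Lemma derive_lipschitz z h v : `|z - z0| < r -> `|h| < r ->
  `|'D_v F (h + z) - 'D_v F z| <= 4 * M * `|h| * `|v| / r ^+ 2.
Proof.
move=> zr hr; have E (x : V) : `|x - z| < r -> `|x - z0| < 2 * r.
  move=> xz; rewrite -(subrK z x) (_ : 2 * r = r + r); last by ring.
  exact: ltr_dist_split.
have E' (x : V) : `|x - z| < r -> `|h + x - z0| < 3 * r.
  move=> /E xz; rewrite (_ : 3 * r = r + 2 * r); last by ring.
  exact: ltr_dist_split.
have r34 : 3 * r < 4 * r by rewrite ltr_pM2r// ltr_nat.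
have r24 : 2 * r < 4 * r by rewrite ltr_pM2r// ltr_nat.
have zz : `|z - z| < r by rewrite subrr normr0.
have := @cauchy_estimate_dir V (fun x => F (h + x) - F x) z v r
  (2 * M * `|h| / r) r0.
have -> : 'D_v (fun x => F (h + x) - F x) z = 'D_v F (h + z) - 'D_v F z.
  have D1 := (is_derive_translate F z h v _).1
    (derivableP (@dF' _ v (lt_trans (E' _ zz) r34))).
  have D2 := derivableP (@dF' _ v (lt_trans (E _ zz) r24)).
  exact: derive_val.
rewrite -ler_pdivlMr// => K.
have -> : 4 * M * `|h| * `|v| / r ^+ 2 = 2 * (2 * M * `|h| / r) * `|v| / r.
  by field; rewrite gt_eqF.
apply: K => x xz.
  apply: differentiableB; last exact: dF (lt_trans (E _ xz) r24).
  apply: (@differentiable_comp _ _ _ _ (fun x => h + x) F).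
    exact: differentiableD.
  exact: dF (lt_trans (E' _ xz) r34).
exact: increment_bound (E _ xz) hr.
Qed.

(** The mean value bound on [0, 1] for [F (t *: h + z) - t *: 'D_h F z], whose derivative
    [derive_lipschitz] controls with [v = h]. *)
Lemma taylor_bound z h : `|z - z0| < r -> `|h| < r ->
  `|F (h + z) - F z - 'D_h F z| <= 4 * M * `|h| ^+ 2 / r ^+ 2.
Proof.
move=> zr hr.
have E (t : R) : 0 <= t <= 1 -> `|t%:C *: h + z - z0| < 4 * r.
  move=> tI; apply: (@lt_trans _ _ (r + r)).
    by apply: ltr_dist_split => //; exact: norm_scale_lt.
  by rewrite (_ : r + r = 2 * r) ?ltr_pM2r ?ltr_nat//; ring.
pose phi (t : C) := F (t *: h + z) - t *: 'D_h F z.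
have D (t : R) : 0 <= t <= 1 ->
    is_derive (t%:C : C) 1 phi ('D_h F (t%:C *: h + z) - 'D_h F z).
  move=> tI; apply: is_deriveB.
    by apply/is_derive_line/derivableP/dF'/E.
  apply/is_deriveP => e e0; exists 1 => // k _.
  by rewrite CscaleE mulr1 scalerDl addrK subrr normr0 mulr_ge0// ltW.
have := @mean_value_bound C phi 0 1 (4 * M * `|h| ^+ 2 / r ^+ 2).
rewrite /phi addr0 !scale1r !scale0r add0r subr0 addrAC; apply => t tI.
  by rewrite CscaleE mulr1 addr0; have [] := D t tI.
rewrite CscaleE mulr1 addr0; have [_ ->] := D t tI.
apply: le_trans (derive_lipschitz _ zr (norm_scale_lt tI hr)) _.
have M0 : 0 <= M.
  by apply: le_trans (FM (z := z0) _); rewrite // subrr normr0 mulr_gt0.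
rewrite ler_pM2r ?invr_gt0 ?exprn_gt0// expr2 mulrA ler_wpM2r//.
rewrite ler_wpM2l ?mulr_ge0// normrZ.
have /andP[t0 t1] := tI.
by rewrite ger0_norm ?ler0c// ler_piMl// lecR.
Qed.

Lemma difference_quotient_bound z v (t : C) : t != 0 -> `|z - z0| < r ->
  `|t *: v| < r ->
  `|t^-1 *: (F (t *: v + z) - F z) - 'D_v F z| <= 4 * M * `|t| * `|v| ^+ 2 / r ^+ 2.
Proof.
move=> t0 zr tvr.
have Fz : differentiable F z.
  by apply: dF; apply: lt_le_trans zr _; rewrite ler_peMl ?(ltW r0)// ler1n.
have DE : 'D_(t *: v) F z = t *: 'D_v F z by rewrite !deriveE// linearZ.
have -> : t^-1 *: (F (t *: v + z) - F z) - 'D_v F z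
    = t^-1 *: (F (t *: v + z) - F z - 'D_(t *: v) F z).
  by rewrite DE [RHS]scalerBr scalerA mulVf// scale1r.
rewrite normrZ normfV ler_pdivrMl ?normr_gt0//.
apply: (le_trans (taylor_bound zr tvr)); rewrite normrZ.
by rewrite le_eqVlt; apply/orP; left; apply/eqP; ring.
Qed.

(* The quotients (F(z + t v) - F z) / t converge to D_v F at rate O(t), uniformly
   in z near z0; Cauchy's estimate for the difference of two of them shows that
   the difference quotients of D_u F along v are Cauchy. *)
Lemma cauchy_difference_quotient (u v : V) (s t : C) : s != 0 -> t != 0 ->
  `|s *: v| < r -> `|t *: v| < r ->
  `|t^-1 *: ('D_u F (t *: v + z0) - 'D_u F z0)
    - s^-1 *: ('D_u F (s *: v + z0) - 'D_u F z0)| * r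
  <= 2 * (4 * M * (`|t| + `|s|) * `|v| ^+ 2 / r ^+ 2) * `|u|.
Proof.
move=> s0 t0 sv tv.
have dq (k : C) x : `|x - z0| < r -> `|k *: v| < r ->
    differentiable (fun x => k^-1 *: (F (k *: v + x) - F x)) x.
  move=> xr kr; apply: differentiableZ; apply: differentiableB.
    apply: (@differentiable_comp _ _ _ _ (fun x => k *: v + x) F).
      exact: differentiableD.
    apply: dF; apply: (@lt_trans _ _ (r + r)); first exact: ltr_dist_split.
    by rewrite (_ : r + r = 2 * r) ?ltr_pM2r ?ltr_nat//; ring.
  by apply: dF; apply: lt_le_trans xr _; rewrite ler_peMl ?(ltW r0)// ler1n.
have zz : `|z0 - z0| < r by rewrite subrr normr0.
have qD (k : C) : `|k *: v| < r ->
    is_derive z0 u (fun x => k^-1 *: (F (k *: v + x) - F x))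
      (k^-1 *: ('D_u F (k *: v + z0) - 'D_u F z0)).
  move=> kr; apply: is_deriveZ; apply: is_deriveB.
    apply/is_derive_translate/derivableP/dF'.
    apply: (@lt_trans _ _ (r + r)); first exact: ltr_dist_split.
    by rewrite (_ : r + r = 2 * r) ?ltr_pM2r ?ltr_nat//; ring.
  by apply/derivableP/dF'; rewrite subrr normr0 mulr_gt0.
pose G x := t^-1 *: (F (t *: v + x) - F x) - s^-1 *: (F (s *: v + x) - F x).
have <- : 'D_u G z0 = t^-1 *: ('D_u F (t *: v + z0) - 'D_u F z0)
    - s^-1 *: ('D_u F (s *: v + z0) - 'D_u F z0).
  by have := qD t tv; have := qD s sv => D1 D2; exact: derive_val.
apply: cauchy_estimate_dir => // x xr.
  by apply: differentiableB; exact: dq.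
rewrite /G; set A := t^-1 *: _; set B := s^-1 *: _.
have -> : A - B = (A - 'D_v F x) - (B - 'D_v F x).
  by rewrite opprB addrA subrK.
apply: (le_trans (ler_normB _ _)).
have -> : 4 * M * (`|t| + `|s|) * `|v| ^+ 2 / r ^+ 2 =
    4 * M * `|t| * `|v| ^+ 2 / r ^+ 2 + 4 * M * `|s| * `|v| ^+ 2 / r ^+ 2 by ring.
by apply: lerD; exact: difference_quotient_bound.
Qed.

Lemma derivable_derive_ball (u v : V) : derivable ('D_u F) z0 v.
Proof.
(* The constant in front of [|t| + |s|] in [cauchy_difference_quotient], increased by 1 to be
   positive. *)
pose Q : C := 8 * M * `|v| ^+ 2 * `|u| / r ^+ 3 + 1.
have M0 : 0 <= M.
  by apply: le_trans (FM (z := z0) _); rewrite // subrr normr0 mulr_gt0.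
have Q0 : 0 < Q.
  by rewrite ltr_wpDl// !(mulr_ge0, invr_ge0, exprn_ge0)// ltW.
have v1 : 0 < `|v| + 1 by rewrite ltr_wpDl.
apply/cauchy_cvgP; apply: cauchy_exP => e e0.
(* Below [dl] both [|t| * a < 1] and [|t| * b < 1] hold: the first gives [Q * |t| < e / 2], the
   second [|t *: v| < r]. The quotient at the fixed parameter [dl / 2] is the centre of the Cauchy
   ball. *)
pose a := 2 * Q / e; pose b := (`|v| + 1) / r.
have a0 : 0 < a by rewrite divr_gt0// mulr_gt0.
have b0 : 0 < b by rewrite divr_gt0.
have ab0 : 0 < a + b by rewrite addr_gt0.
pose dl := (a + b)^-1.
have dl0 : 0 < dl by rewrite invr_gt0.
have small (t : C) : `|t| < dl -> `|t *: v| < r /\ Q * `|t| < e / 2.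
  rewrite -[dl]mul1r ltr_pdivlMr// mulrDr => tab.
  have t0 := normr_ge0 t; split.
    have : `|t| * b < 1 by apply: le_lt_trans tab; rewrite lerDr mulr_ge0 // ltW.
    rewrite mulrA ltr_pdivrMr// mul1r normrZ; apply: le_lt_trans.
    by rewrite ler_wpM2l// lerDl.
  have : `|t| * a < 1 by apply: le_lt_trans tab; rewrite lerDl mulr_ge0 // ltW.
  rewrite mulrA ltr_pdivrMr// mul1r ltr_pdivlMr//.
  by have -> : `|t| * (2 * Q) = Q * `|t| * 2 by ring.
have s0 : dl / 2 != 0 by rewrite gt_eqF// divr_gt0.
have [sv sQ] : `|dl / 2 *: v| < r /\ Q * `|dl / 2| < e / 2.
  apply: small; rewrite gtr0_norm ?divr_gt0//.
  by rewrite ltr_pdivrMr// ltr_pMr// ltr1n.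
exists ((dl / 2)^-1 *: ('D_u F (dl / 2 *: v + z0) - 'D_u F z0)).
exists dl => // t; rewrite /ball_ /= sub0r normrN => tdl t0.
have [tv tQ] := small t tdl.
rewrite -ball_normE /ball_ /= distrC.
rewrite (splitr e); apply: le_lt_trans (ltrD tQ sQ); rewrite -mulrDr.
have := cauchy_difference_quotient u s0 t0 sv tv.
rewrite -ler_pdivlMr// => /le_trans; apply.
rewrite /Q [leRHS]mulrDl ler_wpDr ?mul1r ?addr_ge0// le_eqVlt; apply/orP; left; apply/eqP.
by field; rewrite gt_eqF.
Qed.

End Ball.

(** Continuity at [z] supplies the local bound on [F] that the quantitative version asks for. *)
Theorem derivable_derive (V : normedModType C) (F : V -> H) (U : set V) (z u v : V) :
  open U -> U z -> (forall x, U x -> differentiable F x) ->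
  derivable ('D_u F) z v.
Proof.
move=> oU Uz dF.
have cF : {for z, continuous F} by apply/differentiable_continuous/dF.
have : \forall x \near z, U x /\ `|F x| <= `|F z| + 1.
  near=> x; split; first by near: x; exact: open_nbhs_nbhs.
  rewrite -(subrK (F z) (F x)) addrC; apply: (le_trans (ler_normD _ _)).
  rewrite lerD2l distrC; near: x.
  exact: (@cvgr_dist_le _ _ _ _ _ F (F z) cF).
move=> /nbhs_ballP[r /= r0 B].
have B' x : `|x - z| < 4 * (r / 4) -> U x /\ `|F x| <= `|F z| + 1.
  by move=> xz; apply: B; rewrite -ball_normE /ball_ /= distrC;
     rewrite mulrC divfK// in xz.
apply: (@derivable_derive_ball V F z (r / 4) (`|F z| + 1)).
- by rewrite divr_gt0.
- by move=> x /B'[/dF].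
- by move=> x /B'[].
Unshelve. all: by end_near. Qed.

End BanachHolomorphic.

(** * Wirtinger derivatives and curvature *)

Lemma dot_conj (K : numClosedFieldType) (U : lmodType K)
    (dot : {dot U for Num.conj}) (u v : U) : dot u v = Num.conj (dot v u).
Proof. by rewrite hermC expr0 mul1r. Qed.

(** Homogeneity from the derivative in one direction alone: it is applied to ['D_u gam], for which
    directional derivatives are all that has been established. *)
Lemma is_derive_scale (K : numFieldType) (V W : normedModType K) (f : V -> W)
    (a v : V) (d : W) (c : K) :
  is_derive a v f d -> is_derive a (c *: v) f (c *: d).
Proof.
move=> /is_deriveP H; apply/is_deriveP => e e0.
have c1 : 0 < `|c| + 1 by rewrite ltr_wpDl.
have [dl dl0 K'] := H (e / (`|c| + 1)) (divr_gt0 e0 c1).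
exists (dl / (`|c| + 1)); first by rewrite divr_gt0.
move=> h; rewrite ltr_pdivlMr// => hdl.
have := K' (h * c); rewrite !scalerA => /(_ _)/le_trans; apply.
  by rewrite normrM; apply: le_lt_trans hdl; rewrite ler_wpM2l// lerDl.
rewrite normrM mulrCA [leRHS]mulrC ler_wpM2l//.
by rewrite mulrAC ler_pdivrMr// ler_wpM2l ?(ltW e0)// lerDl.
Qed.

Section RealDerivative.
Context {R : realType}.
Local Notation C := (Cplx R).

Lemma conj_real_complex (t : R) : Num.conj (t%:C : C) = t%:C.
Proof. exact: conjc_real. Qed.

Lemma conj_i : Num.conj ('i : C) = - 'i.
Proof. by apply/eqP; rewrite eq_complex /= oppr0 !eqxx. Qed.

(** The derivative at 0 in a real parameter. The scalars of [W] are complex, so [t] enters the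
    quotient through its embedding in [C]. *)
Definition rderiv (W : normedModType C) (g : R -> W) (d : W) : Prop :=
  (t%:C)^-1 *: (g t - g 0) @[t --> (0 : R)^'] --> d.

Lemma cvg_real_complex : (t%:C : C) @[t --> (0 : R)^'] --> (0 : C)^'.
Proof.
move=> A [_ /gt0_real[e e0 ->] B]; exists e => // t.
rewrite /ball_ /= sub0r normrN => te t0; apply: B.
  by rewrite /ball_ /= sub0r normrN normCE /= expr0n addr0 sqrtr_sqr ltcR.
by apply: contra_neq t0 => -[].
Qed.

Lemma continuous_real_complex0 : (t%:C : C) @[t --> (0 : R)] --> (0 : C).
Proof.
move=> A [_ /gt0_real[e e0 ->] B]; exists e => // t.
rewrite /ball_ /= sub0r normrN => te; apply: B.
by rewrite /ball_ /= sub0r normrN normCE /= expr0n addr0 sqrtr_sqr ltcR.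
Qed.

Lemma cvg_real_complex0 : (t%:C : C) @[t --> (0 : R)^'] --> (0 : C).
Proof. by apply: cvg_trans cvg_real_complex _; exact: cvg_within. Qed.

Lemma is_derive_rderiv (V W : normedModType C) (F : V -> W) (z v : V) d :
  is_derive z v F d -> rderiv (fun t => F (z + t%:C *: v)) d.
Proof.
move=> [dF <-]; rewrite /rderiv scale0r addr0.
pose q (h : C) := h^-1 *: (F (h *: v + z) - F z).
have K : q t%:C @[t --> (0 : R)^'] --> 'D_v F z.
  exact: (cvg_comp _ _ cvg_real_complex dF).
apply: cvg_trans K; apply: near_eq_cvg; apply: nearW => t.
by rewrite /q [z + _]addrC.
Qed.

Lemma rderiv_cvg (W : normedModType C) (g : R -> W) d : rderiv g d ->
  g t @[t --> (0 : R)^'] --> g 0.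
Proof.
move=> gd;
have K : g 0 + t%:C *: ((t%:C)^-1 *: (g t - g 0)) @[t --> (0 : R)^']
    --> g 0 + (0 : C) *: d.
  by apply: cvgD; [exact: cvg_cst|apply: cvgZ => //; exact: cvg_real_complex0].
rewrite scale0r addr0 in K; apply: cvg_trans K; apply: near_eq_cvg.
near=> t; rewrite scalerA divff ?scale1r 1?addrC ?subrK//.
apply/eqP => -[]; apply/eqP; near: t; exact: nbhs_dnbhs_neq.
Unshelve. all: by end_near. Qed.

Lemma near_rderiv (W : normedModType C) (f g : R -> W) d : rderiv f d ->
  (\forall t \near (0 : R), f t = g t) -> rderiv g d.
Proof.
move=> fd fg; apply: cvg_trans fd; apply: near_eq_cvg.
have fg0 : f 0 = g 0 by exact: nbhs_singleton fg.
apply: (@cvg_within _ (nbhs (0 : R))); near=> t; rewrite fg0; congr (_ *: (_ - _)).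
by near: t.
Unshelve. all: by end_near. Qed.

Lemma cvg_Re (T : Type) (F : set_system T) (FF : Filter F) (f : T -> C) (l : C) :
  f @ F --> l -> complex.Re (f t) @[t --> F] --> complex.Re l.
Proof.
move=> /cvgrPdist_le fl; apply/cvgrPdist_le => e e0.
have e0' : 0 < e%:C :> C by rewrite ltcR.
apply: filterS (fl _ e0') => t H; rewrite -lecR; apply: le_trans H.
apply: le_trans (norm_Re_le _); rewrite lecR le_eqVlt; apply/orP; left.
by case: (l) (f t) => [? ?] [? ?].
Qed.

Lemma cvg_Im (T : Type) (F : set_system T) (FF : Filter F) (f : T -> C) (l : C) :
  f @ F --> l -> complex.Im (f t) @[t --> F] --> complex.Im l.
Proof.
move=> /cvgrPdist_le fl; apply/cvgrPdist_le => e e0.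
have e0' : 0 < e%:C :> C by rewrite ltcR.
apply: filterS (fl _ e0') => t H; rewrite -lecR; apply: le_trans H.
apply: le_trans (norm_Im_le _); rewrite lecR le_eqVlt; apply/orP; left.
by case: (l) (f t) => [? ?] [? ?].
Qed.

Lemma rderiv_Re_Im (g : R -> C) (d : C) : rderiv g d ->
  is_derive (0 : R) 1 (fun t => complex.Re (g t)) (complex.Re d) /\
  is_derive (0 : R) 1 (fun t => complex.Im (g t)) (complex.Im d).
Proof.
move=> gd.
have inv (t : R) : (t%:C)^-1 = (t^-1)%:C :> C by rewrite fmorphV.
have K1 := cvg_Re (dnbhs_filter (0 : R)) gd.
have K2 := cvg_Im (dnbhs_filter (0 : R)) gd.
have H1 : t^-1 *: (complex.Re (g (t *: 1 + 0)) - complex.Re (g 0))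
    @[t --> (0 : R)^'] --> complex.Re d.
  rewrite (_ : (fun t : R => _) =
    (fun t => complex.Re ((t%:C)^-1 *: (g t - g 0)))) //; apply/funext => t.
  rewrite addr0 [t%:A]mulr1 inv CscaleE.
  by case: (g t) (g 0) => [? ?] [? ?] /=; rewrite mul0r subr0.
have H2 : t^-1 *: (complex.Im (g (t *: 1 + 0)) - complex.Im (g 0))
    @[t --> (0 : R)^'] --> complex.Im d.
  rewrite (_ : (fun t : R => _) =
    (fun t => complex.Im ((t%:C)^-1 *: (g t - g 0)))) //; apply/funext => t.
  rewrite addr0 [t%:A]mulr1 inv CscaleE.
  by case: (g t) (g 0) => [? ?] [? ?] /=; rewrite mul0r addr0.
by split; apply: DeriveDef; [apply/cvg_ex; eexists; exact: H1|exact: cvg_lim H1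
  |apply/cvg_ex; eexists; exact: H2|exact: cvg_lim H2].
Qed.

Lemma rderivM (f g : R -> C) (df dg : C) : rderiv f df -> rderiv g dg ->
  rderiv (fun t => f t * g t) (df * g 0 + f 0 * dg).
Proof.
move=> fd gd; have gc := rderiv_cvg gd.
have fd' : ((t%:C)^-1 * (f t - f 0) : C) @[t --> (0 : R)^'] --> df by exact: fd.
have gd' : ((t%:C)^-1 * (g t - g 0) : C) @[t --> (0 : R)^'] --> dg by exact: gd.
have f0 : (f 0 : C) @[t --> (0 : R)^'] --> f 0 by exact: cvg_cst.
have K := cvgD (cvgM fd' gc) (cvgM f0 gd').
rewrite /rderiv (_ : (fun t : R => _) = (fun t : R =>
  (t%:C)^-1 * (f t - f 0) * g t + f 0 * ((t%:C)^-1 * (g t - g 0)))).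
  exact: K.
by apply/funext => t; rewrite CscaleE; ring.
Qed.

Lemma rderivV (f : R -> C) (df : C) : f 0 != 0 -> rderiv f df ->
  rderiv (fun t => (f t)^-1) (- df / f 0 ^+ 2).
Proof.
move=> f0 fd; have fc := rderiv_cvg fd.
have fd' : ((t%:C)^-1 * (f t - f 0) : C) @[t --> (0 : R)^'] --> df by exact: fd.
have f0c : ((f 0)^-1 : C) @[t --> (0 : R)^'] --> (f 0)^-1 by exact: cvg_cst.
have K : - ((t%:C)^-1 * (f t - f 0)) * ((f t)^-1 * (f 0)^-1)
    @[t --> (0 : R)^'] --> - df / f 0 ^+ 2.
  by rewrite -exprVn expr2; exact: (cvgM (cvgN fd') (cvgM (cvgV f0 fc) f0c)).
apply: cvg_trans K; apply: near_eq_cvg.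
near=> t.
have ft : f t != 0.
  near: t; exact: (@cvgr_neq0 _ _ _ _ _ _ _ fc f0).
rewrite !CscaleE; set c := (t%:C)^-1; field; rewrite ft f0.
Unshelve. all: by end_near. Qed.

Lemma real_deriveE n (v : 'rV[C]_n) (g : 'rV[C]_n -> C) z d :
  rderiv (fun t => g (z + t%:C *: v)) d -> real_derive v g z = d.
Proof.
move=> /rderiv_Re_Im[[_ H1] [_ H2]]; rewrite /real_derive !derive1E H1 H2.
by case: d {H1 H2}.
Qed.

(** The derivative of the real function [F] is written [d + Num.conj d] so that its C-linear and
    antilinear parts in the direction remain visible to the Wirtinger operators. *)
Lemma real_derive_ln n (v : 'rV[C]_n) (F : 'rV[C]_n -> C) z d : 0 < F z ->
  rderiv (fun t => F (z + t%:C *: v)) (d + Num.conj d) ->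
  real_derive v (fun z => (ln (complex.Re (F z)))%:C) z = (d + Num.conj d) / F z.
Proof.
move=> /gt0_real[r r0 Fz] /rderiv_Re_Im[D _].
rewrite /real_derive.
have -> : derive1 (fun t : R => complex.Im (ln (complex.Re (F (z + t%:C *: v))))%:C) 0 = 0.
  exact: derive1_cst.
have L : is_derive (complex.Re (F (z + (0 : R)%:C *: v))) 1 (@ln R) r^-1.
  by rewrite scale0r addr0 Fz /=; exact: is_derive1_ln.
have := is_derive1_comp L D; move=> [_ E].
rewrite derive1E /= [LHS](_ : _ = (r^-1 * complex.Re (d + Num.conj d))%:C); last first.
  by congr (_ +i* _).
rewrite Fz.
have -> : d + Num.conj d = (complex.Re (d + Num.conj d))%:C.
  by case: (d) => x y /=; apply/eqP; rewrite eq_complex /= subrr !eqxx.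
by rewrite rmorphM fmorphV mulrC.
Qed.

(* [a z] is the C-linear part of the real differential of F at z; [p j] and [q j]
   are the C-linear and antilinear parts of that of z |-> conj (a z e_j) at w. *)
Lemma curvatureE n (F : 'rV[C]_n -> C) (w : 'rV[C]_n)
    (a : 'rV[C]_n -> 'rV[C]_n -> C) (p q : 'I_n -> 'rV[C]_n -> C) :
  (\forall z \near w, 0 < F z /\ forall v,
     rderiv (fun t => F (z + t%:C *: v)) (a z v + Num.conj (a z v)) /\
     a z ('i *: v) = 'i * a z v) ->
  (forall j v, rderiv (fun t => Num.conj (a (w + t%:C *: v) (delta_mx 0 j)))
                 (p j v + q j v)) ->
  (forall j v, p j ('i *: v) = 'i * p j v) ->
  (forall j v, q j ('i *: v) = - 'i * q j v) ->
  curvature F w = - \matrix_(i, j)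
    (p j (delta_mx 0 i) / F w
     - Num.conj (a w (delta_mx 0 j)) * a w (delta_mx 0 i) / F w ^+ 2).
Proof.
move=> Fn bd pi qi.
have ii : 'i * 'i = -1 :> C by rewrite -expr2; exact: sqr_i.
have conji x : Num.conj ('i * x : C) = - 'i * Num.conj x.
  by rewrite rmorphM; congr (_ * _); exact: conj_i.
have [Fw Dw] := nbhs_singleton Fn.
pose P j z := Num.conj (a z (delta_mx 0 j)) / F z.
(* Combining the directions e_j and i e_j cancels the C-linear part and keeps the antilinear one. *)
have PE j : \forall z \near w,
    wirtinger_bar j (fun z => (ln (complex.Re (F z)))%:C) z = P j z.
  apply: filterS Fn => z [Fz Dz]; rewrite /wirtinger_bar.
  have [D1 _] := Dz (delta_mx 0 j); have [D2 E2] := Dz ('i *: delta_mx 0 j).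
  rewrite (real_derive_ln Fz D1) (real_derive_ln Fz D2) /P (Dz _).2 conji.
  set x := a _ _; set y := Num.conj x.
  rewrite mulrA mulrDr mulrA ii [_ * (- _ * _)]mulrA mulrN ii.
  field; rewrite gt_eqF//.
rewrite /curvature; congr (- _); apply/matrixP => i j; rewrite !mxE.
have lin v : real_derive v (wirtinger_bar j (fun z => (ln (complex.Re (F z)))%:C)) w
    = (p j v + q j v) / F w
      - Num.conj (a w (delta_mx 0 j)) * (a w v + Num.conj (a w v)) / F w ^+ 2.
  apply: real_deriveE.
  have F0 : F (w + (0 : R)%:C *: v) = F w by rewrite scale0r addr0.
  have Fn0 : F (w + (0 : R)%:C *: v) != 0 by rewrite F0 gt_eqF.
  have := rderivM (bd j v) (rderivV Fn0 (Dw v).1).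
  rewrite F0 scale0r addr0 => D.
  have -> : (p j v + q j v) / F w
      - Num.conj (a w (delta_mx 0 j)) * (a w v + Num.conj (a w v)) / F w ^+ 2
     = (p j v + q j v) / F w + Num.conj (a w (delta_mx 0 j)) *
         (- (a w v + Num.conj (a w v)) / F w ^+ 2) by ring.
  apply: near_rderiv D _.
  have K : (w + t%:C *: v) @[t --> (0 : R)] --> w.
    rewrite -[X in _ --> X]addr0 -[X in _ + X](scale0r v).
    apply: cvgD; first exact: cvg_cst.
    by apply: cvgZ; [exact: continuous_real_complex0|exact: cvg_cst].
  have K2 : \forall t \near (0 : R), wirtinger_bar j
      (fun z => (ln (complex.Re (F z)))%:C) (w + t%:C *: v)
      = P j (w + t%:C *: v) := K _ (PE j).
  by apply: filterS K2 => t ->.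
(* Now the C-linear parts survive: [q] and the conjugate of [a w] in the direction e_i drop out. *)
rewrite /wirtinger !lin pi qi (Dw _).2 conji.
set z := Num.conj (a w (delta_mx 0 j)).
set x := a w (delta_mx 0 i); set y := Num.conj x.
set P' := p _ _; set Q := q _ _.
have -> : 'i * P' + - 'i * Q = 'i * (P' - Q) by ring.
have -> : 'i * x + - 'i * y = 'i * (x - y) by ring.
have -> : 'i * ('i * (P' - Q) / F w - z * ('i * (x - y)) / F w ^+ 2)
  = ('i * 'i) * ((P' - Q) / F w - z * (x - y) / F w ^+ 2) by ring.
rewrite ii; field; rewrite gt_eqF//.
Qed.

End RealDerivative.

(** * The curvature of a frame as a normalized Gram matrix *)

Section Gram.
Context {R : realType} {n : nat}.
Local Notation C := (Cplx R).
Context (H : completeNormedModType C) (dot : {dot H for Num.conj}).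
Hypothesis hH : is_hilbert dot.

Lemma cvg_dot (T : Type) (F : set_system T) (FF : Filter F) (f g : T -> H)
    (a b : H) : f @ F --> a -> g @ F --> b ->
  dot (f t) (g t) @[t --> F] --> dot a b.
Proof.
move=> fa gb; apply/cvgrPdist_le => e e0.
have a1 : 0 < `|a| + 1 by rewrite ltr_wpDl.
have b1 : 0 < `|b| + 1 by rewrite ltr_wpDl.
have ea : 0 < e / 2 / (`|a| + 1) by rewrite !divr_gt0.
have eb : 0 < e / 2 / (`|b| + 1) by rewrite !divr_gt0.
have gn := (cvgrPdist_le _ _).1 gb 1 ltr01.
have ga := (cvgrPdist_le _ _).1 gb _ ea.
have fb := (cvgrPdist_le _ _).1 fa _ eb.
near=> t.
have -> : dot a b - dot (f t) (g t) = dot a (b - g t) + dot (a - f t) (g t).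
  by rewrite (linearBr dot) (linearBl dot) addrA subrK.
apply: (le_trans (ler_normD _ _)); rewrite (splitr e); apply: lerD.
  apply: (le_trans (norm_dot hH _ _)).
  apply: (@le_trans _ _ ((`|a| + 1) * (e / 2 / (`|a| + 1)))).
    apply: ler_pM => //; first by rewrite lerDl.
    by near: t; exact: ga.
  by rewrite mulrC divfK// gt_eqF.
apply: (le_trans (norm_dot hH _ _)).
apply: (@le_trans _ _ (e / 2 / (`|b| + 1) * (`|b| + 1))).
  apply: ler_pM => //; first by near: t; exact: fb.
  rewrite -(subKr b (g t)); apply: (le_trans (ler_normB _ _)).
  by rewrite lerD2l; near: t; exact: gn.
by rewrite divfK// gt_eqF.
Unshelve. all: by end_near. Qed.

Lemma rderiv_dot (f g : R -> H) (df dg : H) : rderiv f df -> rderiv g dg ->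
  rderiv (fun t => dot (f t) (g t)) (dot df (g 0) + dot (f 0) dg).
Proof.
move=> fd gd; have gc := rderiv_cvg gd.
have f0 : (f 0 : H) @[t --> (0 : R)^'] --> f 0 by exact: cvg_cst.
have K := cvgD (cvg_dot (dnbhs_filter _) fd gc) (cvg_dot (dnbhs_filter _) f0 gd).
rewrite /rderiv (_ : (fun t : R => _) = (fun t : R =>
  dot ((t%:C)^-1 *: (f t - f 0)) (g t) + dot (f 0) ((t%:C)^-1 *: (g t - g 0)))).
  exact: K.
apply/funext => t.
have cj : Num.conj ((t%:C)^-1 : C) = (t%:C)^-1.
  by rewrite fmorphV /= conj_real_complex.
rewrite linearZl_LR linearZr_LR /= cj (linearBl dot) (linearBr dot) !CscaleE.
ring.
Qed.

Lemma curvature_gram (gam : 'rV[C]_n -> H) (U : set 'rV[C]_n) (w : 'rV[C]_n) :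
  open U -> U w -> (forall z, U z -> differentiable gam z) ->
  (forall z, U z -> gam z != 0) ->
  curvature (fun z => `|gam z| ^+ 2) w = - \matrix_(i, j)
    (dot ('D_(delta_mx 0 i) gam w) ('D_(delta_mx 0 j) gam w) / `|gam w| ^+ 2
     - dot (gam w) ('D_(delta_mx 0 j) gam w)
       * dot ('D_(delta_mx 0 i) gam w) (gam w) / (`|gam w| ^+ 2) ^+ 2).
Proof.
move=> oU Uw dg g0.
have gd z v : U z -> is_derive z v gam ('D_v gam z).
  by move=> Uz; apply/derivableP/diff_derivable/dg.
have Dscale z c v : U z -> 'D_(c *: v) gam z = c *: 'D_v gam z.
  by move=> Uz; have [_ ->] := is_derive_scale c (gd z v Uz).
have d2 u v : is_derive w v ('D_u gam) ('D_v ('D_u gam) w).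
  by apply/derivableP; exact: (derivable_derive hH oU Uw dg).
have D2scale u c v : 'D_(c *: v) ('D_u gam) w = c *: 'D_v ('D_u gam) w.
  by have [_ ->] := is_derive_scale c (d2 u v).
(* Product rule: the derivative of [dot (gam z) ('D_j gam z)] along [v] splits into a term linear in
   [v] and the term with second derivatives, antilinear because [dot] is so in its second
   argument. *)
rewrite (@curvatureE R n _ w (fun z v => dot ('D_v gam z) (gam z))
  (fun j v => dot ('D_v gam w) ('D_(delta_mx 0 j) gam w))
  (fun j v => dot (gam w) ('D_v ('D_(delta_mx 0 j) gam) w))).
- congr (- _); apply/matrixP => i j; rewrite !mxE.
  by rewrite -(dot_conj dot).
- apply: filterS (open_nbhs_nbhs (conj oU Uw)) => z Uz; split.
    by rewrite exprn_gt0// normr_gt0 g0.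
  move=> v; rewrite Dscale// linearZl_LR; split=> //.
  have := rderiv_dot (is_derive_rderiv (gd z v Uz)) (is_derive_rderiv (gd z v Uz)).
  rewrite scale0r addr0 -(dot_conj dot (gam z)).
  by rewrite (_ : (fun t => dot _ _) = (fun t => `|gam (z + t%:C *: v)| ^+ 2))//;
     apply/funext => t; rewrite hH.
- move=> j v.
  have := rderiv_dot (is_derive_rderiv (gd w v Uw))
    (is_derive_rderiv (d2 (delta_mx 0 j) v)).
  rewrite scale0r addr0.
  by rewrite (_ : (fun t => dot _ _) = (fun t => Num.conj (dot
    ('D_(delta_mx 0 j) gam (w + t%:C *: v)) (gam (w + t%:C *: v)))))//;
     apply/funext => t; rewrite -(dot_conj dot).
- by move=> j v; rewrite Dscale// linearZl_LR.
- by move=> j v; rewrite D2scale linearZr_LR /= conj_i.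
Qed.

End Gram.

(** * Explicit curvature of the ball kernel *)

Section BallCurvature.
Context {R : realType} {n : nat}.
Local Notation C := (Cplx R).
Implicit Types (u v w z : 'rV[C]_n).

Lemma dotmx_delta v j : dotmx v (delta_mx 0 j) = v 0 j.
Proof.
rewrite dotmxE mxE (bigD1 j)//= !mxE !eqxx rmorph1 mulr1.
rewrite big1 ?addr0// => k kj; rewrite !mxE eqxx /= (negbTE kj).
by rewrite rmorph0 mulr0.
Qed.

Lemma dotmxC u v : dotmx u v = Num.conj (dotmx v u).
Proof. exact: dot_conj. Qed.

Lemma dotmxDl u u' v : dotmx (u + u') v = dotmx u v + dotmx u' v.
Proof. exact: (linearDl (@dotmx C n)). Qed.
Lemma dotmxDr u v v' : dotmx u (v + v') = dotmx u v + dotmx u v'.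
Proof. exact: (linearDr (@dotmx C n)). Qed.
Lemma dotmxZl a u v : dotmx (a *: u) v = a * dotmx u v.
Proof. exact: (linearZl_LR (@dotmx C n)). Qed.
Lemma dotmxZr a u v : dotmx u (a *: v) = Num.conj a * dotmx u v.
Proof. exact: (linearZr_LR (@dotmx C n)). Qed.

Local Opaque dotmx.

Lemma rderiv_line (a b : C) : rderiv (fun t => a + t%:C * b) b.
Proof.
have K : (b : C) @[_ --> (0 : R)^'] --> b by exact: cvg_cst.
apply: cvg_trans K; apply: near_eq_cvg; near=> t.
have t0 : (t%:C : C) != 0.
  by apply/eqP => -[]; apply/eqP; near: t; exact: nbhs_dnbhs_neq.
by rewrite CscaleE mul0r addr0 addrC addKr mulKf.
Unshelve. all: by end_near. Qed.

Lemma rderiv_dotmx z v : rderiv (fun t => dotmx (z + t%:C *: v) (z + t%:C *: v))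
  (dotmx v z + dotmx z v).
Proof.
(* The increment of the squared length is [t] times the affine function
   [dotmx v z + dotmx z v + t * dotmx v v]. *)
have := rderivM (@rderiv_line 0 1) (@rderiv_line (dotmx v z + dotmx z v) (dotmx v v)).
rewrite !mul0r !addr0 mul0r mul1r addr0 => H.
have K : (t%:C)^-1 *: ((0 + t%:C * 1) * (dotmx v z + dotmx z v + t%:C * dotmx v v)
    - 0) @[t --> (0 : R)^'] --> dotmx v z + dotmx z v.
  by move: H; rewrite /rderiv !mul0r addr0 mul0r.
rewrite /rderiv (_ : (fun t : R => _) = (fun t : R =>
 (t%:C)^-1 *: ((0 + t%:C * 1) * (dotmx v z + dotmx z v + t%:C * dotmx v v) - 0))) //.
apply/funext => t; congr (_ *: _); rewrite scale0r addr0.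
rewrite !dotmxDl !dotmxDr !dotmxZl !dotmxZr conj_real_complex.
by move: (dotmx z z) (dotmx v z) (dotmx z v) (dotmx v v) => a b c d; ring.
Qed.

Lemma rderiv_inv_sub1 (f : R -> C) (c d : C) : f 0 = c -> 1 - c != 0 ->
  rderiv f d -> rderiv (fun t => (1 - f t)^-1) (d * (1 - c)^-1 ^+ 2).
Proof.
move=> fc c0 fd.
have D : rderiv (fun t => 1 - f t) (- d).
  rewrite /rderiv (_ : (fun t : R => _) =
    (fun t : R => - ((t%:C)^-1 *: (f t - f 0)))); first exact: cvgN.
  by apply/funext => t; rewrite !CscaleE; ring.
have f0 : 1 - f 0 != 0 by rewrite fc.
by have := rderivV f0 D; rewrite fc opprK -exprVn.
Qed.

Lemma rderiv_line_sqr (k : R -> C) (a b c d : C) : k 0 = c -> rderiv k d ->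
  rderiv (fun t => (a + t%:C * b) * (k t * k t)) (b * c ^+ 2 + a * (2 * c * d)).
Proof.
move=> kc kd; have := rderivM (@rderiv_line a b) (rderivM kd kd).
rewrite kc mul0r addr0.
have -> : b * (c * c) + a * (d * c + c * d) = b * c ^+ 2 + a * (2 * c * d) by ring.
by [].
Qed.

Lemma ball_curvatureE w : open (@unit_ball R n) -> unit_ball w ->
  ball_curvature w = - \matrix_(i, j)
    ((i == j)%:R / (1 - dotmx w w)
     + Num.conj (w 0 i) * w 0 j / (1 - dotmx w w) ^+ 2).
Proof.
move=> oB Bw.
have sgt z : unit_ball z -> 0 < 1 - dotmx z z by rewrite /unit_ball /= subr_gt0.
have cj z : Num.conj (dotmx z z) = dotmx z z by rewrite -dotmxC.
pose K z : C := ball_kernel z z.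
have Kj z : Num.conj (K z) = K z.
  by rewrite /K /ball_kernel fmorphV rmorphB /= rmorph1 cj.
have Kd z v : unit_ball z ->
    rderiv (fun t => K (z + t%:C *: v)) ((dotmx v z + dotmx z v) * K z ^+ 2).
  move=> /sgt z0.
  apply: (@rderiv_inv_sub1 (fun t => dotmx (z + t%:C *: v) (z + t%:C *: v))).
  - by rewrite scale0r addr0.
  - by rewrite gt_eqF.
  - exact: rderiv_dotmx.
have coord v t j : (w + t%:C *: v) 0 j = w 0 j + t%:C * v 0 j by rewrite !mxE.
rewrite /ball_curvature.
(* The conjugate of the linear part in the direction e_j is [z 0 j * K z ^+ 2]; its derivative along
   [v] has [v 0 j] and [dotmx v w] as C-linear terms and [dotmx w v] as antilinear one. *)
rewrite (@curvatureE R n _ w (fun z v => dotmx v z * K z ^+ 2)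
  (fun j v => v 0 j * K w ^+ 2 + 2 * w 0 j * K w ^+ 3 * dotmx v w)
  (fun j v => 2 * w 0 j * K w ^+ 3 * dotmx w v)).
- congr (- _); apply/matrixP => i j; rewrite !mxE -/(K w).
  rewrite rmorphM rmorphXn /= Kj -!dotmxC.
  rewrite (dotmxC (delta_mx 0 i) w) !dotmx_delta [j == i]eq_sym.
  have Kw0 : 1 - dotmx w w != 0 by rewrite gt_eqF// sgt.
  by rewrite /K /ball_kernel; field.
- apply: filterS (open_nbhs_nbhs (conj oB Bw)) => z Bz; split.
    by rewrite /ball_kernel invr_gt0 sgt.
  move=> v; split; last by rewrite dotmxZl -mulrA.
  have := Kd z v Bz; rewrite mulrDl rmorphM rmorphXn /= Kj -dotmxC.
  by [].
- move=> j v.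
  have K0 : K (w + (0 : R)%:C *: v) = K w by rewrite scale0r addr0.
  have := @rderiv_line_sqr (fun t => K (w + t%:C *: v)) (w 0 j) (v 0 j) _ _ K0
    (Kd w v Bw).
  have -> : v 0 j * K w ^+ 2 + w 0 j * (2 * K w * ((dotmx v w + dotmx w v) * K w ^+ 2))
    = v 0 j * K w ^+ 2 + 2 * w 0 j * K w ^+ 3 * dotmx v w
      + 2 * w 0 j * K w ^+ 3 * dotmx w v by ring.
  rewrite (_ : (fun t : R => (_ + _) * _) = (fun t : R =>
    Num.conj (dotmx (delta_mx 0 j) (w + t%:C *: v) * K (w + t%:C *: v) ^+ 2))) //.
  apply/funext => t.
  by rewrite rmorphM rmorphXn /= Kj -dotmxC dotmx_delta coord expr2.
- by move=> j v; rewrite mxE dotmxZl; ring.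
- by move=> j v; rewrite dotmxZr conj_i; ring.
Qed.

End BallCurvature.

(** * Moebius automorphisms of the ball *)

Section Moebius.
Context {R : realType} {n : nat}.
Local Notation C := (Cplx R).
Implicit Types (u v w z h x y : 'rV[C]_n).

Lemma dotmxNl u v : dotmx (- u) v = - dotmx u v.
Proof. exact: (linearNl (@dotmx C n)). Qed.
Lemma dotmxNr u v : dotmx u (- v) = - dotmx u v.
Proof. exact: (linearNr (@dotmx C n)). Qed.
Lemma dotmxBl u u' v : dotmx (u - u') v = dotmx u v - dotmx u' v.
Proof. by rewrite dotmxDl dotmxNl. Qed.
Lemma dotmxBr u v v' : dotmx u (v - v') = dotmx u v - dotmx u v'.
Proof. by rewrite dotmxDr dotmxNr. Qed.
Lemma dotmx_ge0 u : 0 <= dotmx u u.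
Proof. exact: (dnorm_ge0 (@dotmx C n)). Qed.
Lemma dotmx_CS u v : `|dotmx u v| ^+ 2 <= dotmx u u * dotmx v v.
Proof. exact: (dot_CauchySchwarz (@dotmx C n)). Qed.

Lemma differentiable_dotmx v z : differentiable (fun x => dotmx x v) z.
Proof.
rewrite (_ : (fun x => _) = \sum_(j < n) (fun x => Num.conj (v 0 j) *: x 0 j)).
  apply: differentiable_sum => j; apply: differentiableZ.
  exact: differentiable_coord.
apply/funext => x; rewrite fct_sumE dotmxE mxE; apply: eq_bigr => j _.
by rewrite !mxE CscaleE mulrC.
Qed.

Lemma derive_dotmx v z h : 'D_h (fun x => dotmx x v) z = dotmx h v.
Proof.
apply: derive_val; apply/is_deriveP => e e0; exists 1 => // k _.
rewrite dotmxDl dotmxZl addrK CscaleE subrr normr0.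
by rewrite mulr_ge0// ltW.
Qed.

Lemma is_derive_dotmx (V : normedModType C) (f : V -> 'rV[C]_n) (z h : V) v :
  differentiable f z ->
  is_derive z h (fun x : V => dotmx (f x) v) (dotmx ('D_h f z) v).
Proof.
move=> df; have dd := differentiable_dotmx v (f z).
have dc := @differentiable_comp _ _ _ _ f (fun x => dotmx x v) z df dd.
apply: DeriveDef; first exact: (diff_derivable dc).
rewrite (deriveE _ dc) (diff_comp df dd) /= -(deriveE _ df) -(deriveE _ dd).
exact: derive_dotmx.
Qed.

Lemma is_derive_Zl (V W : normedModType C) (k : V -> C) (u : W) (a v : V) (d : C) :
  is_derive a v k d -> is_derive a v (fun y : V => k y *: u) (d *: u).
Proof.
move=> /is_deriveP H; apply/is_deriveP => e e0.
have u1 : 0 < `|u| + 1 by rewrite ltr_wpDl.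
have [dl dl0 K] := H (e / (`|u| + 1)) (divr_gt0 e0 u1).
exists dl => // h /K E; rewrite scalerA -!scalerBl normrZ.
apply: (@le_trans _ _ (e / (`|u| + 1) * `|h| * (`|u| + 1))).
  by apply: ler_pM => //; rewrite lerDl.
by rewrite mulrAC divfK// gt_eqF.
Qed.

Lemma differentiable_homography (V : normedModType C) (p q : V -> C) (a b c : C) (v : V) :
  differentiable p v -> differentiable q v -> 1 - p v != 0 ->
  differentiable (fun y : V => (1 - p y)^-1 * (a - (b *: q y + c *: p y))) v.
Proof.
move=> dp dq p1.
have d1 : differentiable (fun y : V => 1 - p y) v.
  by apply: differentiableB; [exact: differentiable_cst|exact: dp].
have d2 : differentiable (fun y : V => b *: q y + c *: p y) v.
  by apply: differentiableD; apply: differentiableZ.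
have d3 : differentiable (fun y : V => a - (b *: q y + c *: p y)) v.
  by apply: differentiableB; [exact: differentiable_cst|exact: d2].
by apply: differentiableM; [exact: differentiableV|exact: d3].
Qed.

Lemma is_derive_inv_affine (c e : C) : c != 0 ->
  is_derive (0 : C) 1 (fun k => (c - k * e)^-1) (e / c ^+ 2).
Proof.
move=> c0.
have d1 : is_derive (0 : C) 1 (fun k => c - k * e) (- e).
  apply/is_deriveP => d d0; exists 1 => // k _.
  rewrite addr0 !CscaleE mulr1 mul0r subr0.
  have -> : c - k * e - c - k * - e = 0 by ring.
  rewrite normr0.
  by rewrite mulr_ge0// ltW.
have f0 : c - 0 * e != 0 by rewrite mul0r subr0.
have [dd dE] := d1.
apply: DeriveDef; first exact: derivableV.
have -> := @deriveV _ _ (fun k : C => c - k * e) (0 : C) (1 : C) f0 dd.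
by rewrite dE CscaleE mulrNN mul0r subr0 mulrC.
Qed.

Lemma is_derive_quot_affine (c e : C) : c != 0 ->
  is_derive (0 : C) 1 (fun k => k * (c - k * e)^-1) c^-1.
Proof.
move=> c0; have := is_deriveM (is_derive_id (0 : C) 1) (is_derive_inv_affine e c0).
by rewrite scale0r add0r mul0r subr0 CscaleE mulr1.
Qed.

Lemma is_derive_line0 (V W : normedModType C) (F : V -> W) (a b : V) d :
  is_derive (0 : C) 1 (fun t => F (t *: b + a)) d -> is_derive a b F d.
Proof. by move=> /is_derive_line; rewrite scale0r add0r. Qed.

Section Disc.
Variables (w : 'rV[C]_n) (s : C).
Hypotheses (Bw : unit_ball w) (s_gt0 : 0 < s) (defect_sqr : s ^+ 2 = 1 - dotmx w w).

Let conj_s : Num.conj s = s.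
Proof. by rewrite geC0_conj// ltW. Qed.

Let s0 : s != 0. Proof. by rewrite gt_eqF. Qed.
Let s1 : 1 + s != 0. Proof. by rewrite gt_eqF// addr_gt0. Qed.

(* L w = w and L z = s z for z orthogonal to w; the usual formula for the
   Moebius automorphism, without the division by <w, w>. *)
Definition mobius_lin z := s *: z + ((1 + s)^-1 * dotmx z w) *: w.
Local Notation L := mobius_lin.

Lemma dotmx_mobius_lin z v : dotmx (L z) v = s * dotmx z v
  + (1 + s)^-1 * dotmx z w * dotmx w v.
Proof. by rewrite dotmxDl !dotmxZl. Qed.

Lemma mobius_lin_sym z v : dotmx z (L v) = dotmx (L z) v.
Proof.
have E : Num.conj ((1 + s)^-1 * dotmx v w) = (1 + s)^-1 * dotmx w v.
  by rewrite rmorphM fmorphV rmorphD rmorph1 /= conj_s -dotmxC.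
rewrite dotmx_mobius_lin dotmxDr !dotmxZr conj_s E.
by move: (dotmx z v) (dotmx z w) (dotmx w v) => a b c; rewrite mulrAC.
Qed.

Let ww : dotmx w w = (1 - s) * (1 + s).
Proof. have := defect_sqr; rewrite -subr_sqr expr1n => ->; ring. Qed.

Lemma mobius_lin_w : L w = w.
Proof.
rewrite /L ww -scalerDl.
by rewrite mulrCA mulVf// mulr1 addrC subrK scale1r.
Qed.

Lemma dotmx_mobius_lin_w z : dotmx (L z) w = dotmx z w.
Proof. by rewrite -mobius_lin_sym mobius_lin_w. Qed.

Lemma mobius_linD y z : L (y + z) = L y + L z.
Proof. by rewrite /L dotmxDl mulrDr scalerDr scalerDl addrACA. Qed.

Lemma mobius_linZ a z : L (a *: z) = a *: L z.
Proof. by rewrite /L dotmxZl scalerDr !scalerA mulrCA [s * a]mulrC. Qed.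

(** The coefficient of [w] is [s / (1 + s) + 1 / (1 + s) = 1]. As [L] is self-adjoint, this square
    also governs the inner products of its values. *)
Lemma mobius_linK z : L (L z) = s ^+ 2 *: z + dotmx z w *: w.
Proof.
rewrite {1}/L dotmx_mobius_lin_w /L scalerDr !scalerA -addrA -scalerDl.
by congr (_ + _ *: _); field.
Qed.

Lemma dotmx_mobius_lin2 z y :
  dotmx (L z) (L y) = s ^+ 2 * dotmx z y + dotmx z w * dotmx w y.
Proof. by rewrite mobius_lin_sym mobius_linK dotmxDl !dotmxZl. Qed.

Definition mobius z := (1 - dotmx z w)^-1 *: (w - L z).

Lemma dotmx_neq1 z : dotmx z z <= 1 -> 1 - dotmx z w != 0.
Proof.
move=> z1; rewrite subr_eq0; apply/eqP => E.
have := dotmx_CS z w; rewrite -E normr1 expr1n => H.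
have H' : 1 <= dotmx w w by apply: (le_trans H); rewrite ler_piMl// dotmx_ge0.
by have := le_lt_trans H' Bw; rewrite ltxx.
Qed.

(** The identity by which [mobius] preserves the ball: the right-hand side has the sign of
    [1 - dotmx z z]. *)
Lemma mobius_defect z : 1 - dotmx z w != 0 ->
  1 - dotmx (mobius z) (mobius z)
  = s ^+ 2 * (1 - dotmx z z) / `|1 - dotmx z w| ^+ 2.
Proof.
move=> z0; rewrite /mobius dotmxZl dotmxZr fmorphV mulrA -invfM -normCK.
have n0 : `|1 - dotmx z w| ^+ 2 != 0 by rewrite expf_neq0// normr_eq0.
rewrite dotmxBl !dotmxBr dotmx_mobius_lin2 mobius_lin_sym mobius_lin_w.
rewrite dotmx_mobius_lin_w.
have E : `|1 - dotmx z w| ^+ 2 = 1 - dotmx z w - dotmx w z + dotmx z w * dotmx w z.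
  rewrite normCK rmorphB rmorph1 /= -dotmxC.
  by move: (dotmx z w) (dotmx w z) => a b; ring.
apply: (mulIf n0); rewrite divfK// mulrBl mul1r mulrAC mulVf// mul1r E.
rewrite defect_sqr.
by move: (dotmx z w) (dotmx w z) (dotmx z z) (dotmx w w) => a b c d; ring.
Qed.

Lemma ball_dotmx_neq1 z : unit_ball z -> 1 - dotmx z w != 0.
Proof. by move=> Bz; apply: dotmx_neq1; apply: ltW; exact: Bz. Qed.

Lemma mobius_ball z : unit_ball z -> unit_ball (mobius z).
Proof.
move=> Bz; have z0 := ball_dotmx_neq1 Bz.
have z1 : 0 < 1 - dotmx z z by rewrite subr_gt0; exact: Bz.
have E := mobius_defect z0.
have : 0 < 1 - dotmx (mobius z) (mobius z).
  rewrite E; apply: divr_gt0; first by apply: mulr_gt0 => //; exact: exprn_gt0.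
  by apply: exprn_gt0; rewrite normr_gt0.
by rewrite subr_gt0.
Qed.

Lemma mobiusK z : unit_ball z -> mobius (mobius z) = z.
Proof.
move=> Bz; have z0 := ball_dotmx_neq1 Bz.
have LN y : L (- y) = - L y by rewrite -scaleN1r mobius_linZ scaleN1r.
have E : 1 - dotmx (mobius z) w = s ^+ 2 / (1 - dotmx z w).
  rewrite /mobius dotmxZl dotmxBl dotmx_mobius_lin_w defect_sqr.
  move: (dotmx z w) (dotmx w w) z0 => a b a0.
  by field.
rewrite {1}/mobius E /mobius mobius_linZ mobius_linD LN mobius_linK mobius_lin_w.
apply/rowP => j; rewrite !mxE.
have -> : dotmx z w = 1 - (1 - dotmx z w) by rewrite subKr.
move: (1 - dotmx z w) (z 0 j) (w 0 j) z0 => c a b c0.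
by rewrite subKr; field; rewrite s0 c0.
Qed.

Lemma mobius0 : mobius 0 = w.
Proof.
rewrite /mobius /L (_ : dotmx 0 w = 0); last exact: (linear0l (@dotmx C n)).
by rewrite subr0 invr1 scale1r mulr0 scaler0 scale0r addr0 subr0.
Qed.

Lemma mobius_w : mobius w = 0.
Proof. by rewrite /mobius mobius_lin_w subrr scaler0. Qed.

Lemma differentiable_mobius z : 1 - dotmx z w != 0 -> differentiable mobius z.
Proof.
move=> z0.
pose g j x := (1 - dotmx x w)^-1
  * (w 0 j - (s *: x 0 j + ((1 + s)^-1 * w 0 j) *: dotmx x w)).
have gd j : differentiable (g j) z.
  exact: (differentiable_homography _ _ _ (differentiable_dotmx w z)
    (differentiable_coord z 0 j) z0).
rewrite (_ : mobius = \sum_(j < n) (fun x => g j x *: delta_mx 0 j)).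
  by apply: differentiable_sum => j; exact: differentiableZl.
apply/funext => x; rewrite fct_sumE [LHS]row_sum_delta; apply: eq_bigr => j _.
rewrite /g !mxE; congr (_ *: _).
rewrite !CscaleE; move: (dotmx x w) (x 0 j) (w 0 j) => a b c.
by congr (_ * (_ - (_ + _))); rewrite mulrAC.
Qed.

(** Along the line [k *: h + z] both numerator and denominator are affine in [k]. *)
Lemma derive_mobius z h : 1 - dotmx z w != 0 ->
  'D_h mobius z = (dotmx h w / (1 - dotmx z w) ^+ 2) *: (w - L z)
                  - (1 - dotmx z w)^-1 *: L h.
Proof.
move=> z0; apply: derive_val.
have E (k : C) : mobius (k *: h + z)
    = (1 - dotmx z w - k * dotmx h w)^-1 *: (w - L z)
      + (k * (1 - dotmx z w - k * dotmx h w)^-1) *: (- L h).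
  rewrite /mobius mobius_linD mobius_linZ dotmxDl dotmxZl.
  have -> : 1 - (k * dotmx h w + dotmx z w) = 1 - dotmx z w - k * dotmx h w.
    by move: (dotmx z w) (dotmx h w) => a b; ring.
  move: (_ ^-1) (L h) (L z) => f p q.
  by rewrite opprD addrCA addrC scalerDr -scalerN !scalerA [f * k]mulrC.
apply: is_derive_line0.
rewrite (funext E) -scalerN.
apply: is_deriveD; apply: is_derive_Zl.
  exact: is_derive_inv_affine.
exact: is_derive_quot_affine.
Qed.

End Disc.
End Moebius.

(** * Automorphisms of the ball *)

Section Automorphism.
Context {R : realType} {n : nat}.
Local Notation C := (Cplx R).
Implicit Types (u v w z h x y : 'rV[C]_n).

Lemma dotmx0l v : dotmx (0 : 'rV[C]_n) v = 0.
Proof. exact: (linear0l (@dotmx C n)). Qed.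
Lemma unit_ball0 : unit_ball (0 : 'rV[C]_n).
Proof. by rewrite /unit_ball /= dotmx0l ltr01. Qed.

Lemma is_derive_line_origin (V W : normedModType C) (F : V -> W) (a : V) (t : C) d :
  is_derive (t *: a) a F d -> is_derive t 1 (fun s => F (s *: a)) d.
Proof.
move=> /is_deriveP H; apply/is_deriveP => e /H[dl dl0 K]; exists dl => // k /K.
by rewrite CscaleE mulr1 scalerDl.
Qed.

(** For a unit vector [u'] and [v = 'D_u' F 0], the function [dotmx (F (t *: u')) v] is bounded by
    [|v|] on the unit disc and has derivative [|v|^2] at 0, so Schwarz's lemma gives [|v|^2 <= |v|],
    that is, [|v| <= 1]. *)
Lemma ball_contraction (F : 'rV[C]_n -> 'rV[C]_n) (u : 'rV[C]_n) :
  (forall z, unit_ball z -> differentiable F z) ->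
  (forall z, unit_ball z -> unit_ball (F z)) -> F 0 = 0 ->
  dotmx ('D_u F 0) ('D_u F 0) <= dotmx u u.
Proof.
move=> dF BF F0.
have [->|u0] := eqVneq u 0; first by rewrite derive0 dotmx0l.
have uu : 0 < dotmx u u by rewrite (dnorm_gt0 (@dotmx C n)).
have [c c0 cc] : exists2 c : C, 0 < c & c ^+ 2 = dotmx u u.
  by exists (sqrtC (dotmx u u)); [rewrite sqrtC_gt0|exact: sqrtCK].
have cj : Num.conj c = c by rewrite geC0_conj// ltW.
pose u' := c^-1 *: u.
have u'1 : dotmx u' u' = 1.
  rewrite dotmxZl dotmxZr fmorphV /= cj -cc expr2.
  by rewrite mulKf ?mulVf// gt_eqF.
have D0 : differentiable F 0 by apply: dF; exact: unit_ball0.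
pose v := 'D_u' F 0.
have DuE : 'D_u F 0 = c *: v.
  by rewrite /v /u' !deriveE// linearZ /= scalerA divff ?scale1r// gt_eqF.
have Bl (l : C) : `|l| < 1 -> unit_ball (l *: u').
  move=> l1; rewrite /unit_ball /= dotmxZl dotmxZr u'1 mulr1 -normCK.
  by rewrite expr_lt1.
have vv0 := dotmx_ge0 v.
have [m mE] : exists m : R, m%:C = sqrtC (dotmx v v).
  exists (complex.Re (sqrtC (dotmx v v))).
  by apply: RRe_real; apply: ger0_real; rewrite sqrtC_ge0.
have lineD (l : C) : `|l| < 1 ->
    is_derive l 1 (fun t : C => dotmx (F (t *: u')) v) (dotmx ('D_u' F (l *: u')) v).
  move=> /Bl/dF dl.
  exact: is_derive_line_origin (@is_derive_dotmx R n _ F (l *: u') u' v dl).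
pose g (t : C) : C := dotmx (F (t *: u')) v.
have g1 (l : C) : `|l| < 1 -> derivable g l 1 by move=> /lineD[].
have g0 : g 0 = 0 by rewrite /g scale0r F0 dotmx0l.
have g'0 : is_derive (0 : C) 1 g (dotmx v v).
  have l0 : `|0 : C| < 1 by rewrite normr0 ltr01.
  by have := lineD 0 l0; rewrite {1}scale0r.
have gM (l : C) : `|l| < 1 -> `|g l| <= m%:C.
  move=> /Bl/BF Fl; rewrite mE -ler_sqr ?nnegrE ?sqrtC_ge0//.
  rewrite sqrtCK; apply: (le_trans (dotmx_CS _ _)).
  by rewrite ler_piMl//; apply: ltW; exact: Fl.
have := schwarz_Re g1 g0 g'0 gM.
rewrite -lecR mE => H.
have H2 : dotmx v v <= sqrtC (dotmx v v).
  apply: le_trans H; rewrite -{1}(RRe_real (ger0_real vv0)) lecR; exact: ler_norm.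
have H3 : dotmx v v <= 1.
  move: H2 vv0; move: (dotmx v v) => a H2 a0.
  have [->|an0] := eqVneq a 0; first exact: ler01.
  have ap : 0 < a by rewrite lt_def an0.
  have : a ^+ 2 <= a.
    rewrite -[leRHS](sqrtCK a) ler_sqr// nnegrE ?sqrtC_ge0//.
  by rewrite expr2 -[leRHS]mul1r ler_pM2r.
rewrite DuE dotmxZl dotmxZr cj mulrA -expr2 cc.
by apply: ler_piMr; [exact: ltW uu|exact: H3].
Qed.

Lemma derive_comp (U V W : normedModType C) (f : U -> V) (g : V -> W) (a v : U) :
  differentiable f a -> differentiable g (f a) ->
  'D_v (g \o f) a = 'D_('D_v f a) g (f a).
Proof.
move=> df dg; rewrite !deriveE//; last exact: differentiable_comp.
by rewrite diff_comp.
Qed.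

Section Isometry.
Variables (w : 'rV[C]_n) (s : C) (theta : 'rV[C]_n -> 'rV[C]_n).
Hypotheses (Bw : unit_ball w) (s_gt0 : 0 < s) (sE : s ^+ 2 = 1 - dotmx w w).
Hypotheses (autT : automorphism_of unit_ball theta) (thw : theta w = 0).
Local Notation phi := (mobius w s).
Local Notation L := (mobius_lin w s).

Lemma derive_mobius_0 h : 'D_h phi 0 = dotmx h w *: w - L h.
Proof.
have z0 : 1 - dotmx (0 : 'rV[C]_n) w != 0 by rewrite dotmx0l subr0 oner_eq0.
rewrite (derive_mobius _ _ z0) dotmx0l subr0 expr1n invr1 mulr1 scale1r.
by rewrite /mobius_lin dotmx0l mulr0 scaler0 scale0r addr0 subr0.
Qed.

Lemma derive_mobius_w h : 'D_h phi w = - (s ^- 2 *: L h).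
Proof.
have z0 : 1 - dotmx w w != 0 by exact: ball_dotmx_neq1.
rewrite (derive_mobius _ _ z0) (mobius_lin_w s_gt0 sE) subrr scaler0 sub0r.
by rewrite -sE.
Qed.

Lemma differentiable_mobius_ball z : unit_ball z -> differentiable phi z.
Proof. by move=> Bz; apply: differentiable_mobius; exact: ball_dotmx_neq1. Qed.

(* Schwarz's lemma for theta o phi and for its inverse phi o theta^-1. *)
Lemma automorphism_isometry h :
  dotmx ('D_('D_h phi 0) theta w) ('D_('D_h phi 0) theta w) = dotmx h h.
Proof.
have [[oB dth] Bth [psi [[_ dpsi] Bpsi psiK _]]] := autT.
have B0 := unit_ball0.
have phi0 : phi 0 = w by exact: mobius0.
have phiB z : unit_ball z -> unit_ball (phi z) by exact: mobius_ball.
have phiK z : unit_ball z -> phi (phi z) = z by exact: mobiusK.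
have dphi z : unit_ball z -> differentiable phi z by exact: differentiable_mobius_ball.
pose F := theta \o phi; pose G := phi \o psi.
have F0 : F 0 = 0 by rewrite /F /= phi0.
have psi0 : psi 0 = w by rewrite -thw psiK.
have G0 : G 0 = 0 by rewrite /G /= psi0; exact: mobius_w.
have dF z : unit_ball z -> differentiable F z.
  by move=> Bz; apply: differentiable_comp; [exact: dphi|exact/dth/phiB].
have dG z : unit_ball z -> differentiable G z.
  by move=> Bz; apply: differentiable_comp; [exact: dpsi|exact/dphi/Bpsi].
have BF z : unit_ball z -> unit_ball (F z) by move=> Bz; exact/Bth/phiB.
have BG z : unit_ball z -> unit_ball (G z) by move=> Bz; exact/phiB/Bpsi.
have dth0 : differentiable theta (phi 0) by rewrite phi0; exact: dth.
have FE : 'D_h F 0 = 'D_('D_h phi 0) theta w.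
  by rewrite (derive_comp h (dphi 0 B0) dth0) phi0.
rewrite -FE.
apply: le_anti; apply/andP; split; first exact: ball_contraction.
have dG0 : differentiable G (F 0) by rewrite F0; exact: dG.
(* Near 0 the composite of [G] after [F] is the identity, so contraction by the derivative of [G]
   gives the reverse inequality. *)
have hE : 'D_('D_h F 0) G 0 = h.
  have E := derive_comp h (dF 0 B0) dG0; rewrite F0 in E; rewrite -E.
  rewrite -[RHS](derive_id (0 : 'rV[C]_n) h); apply: near_eq_derive.
  apply: filterS (open_nbhs_nbhs (conj oB B0)) => z Bz.
  exact: (etrans (congr1 phi (psiK _ (phiB _ Bz))) (phiK _ Bz)).
rewrite -{1 2}hE; apply: ball_contraction.
- exact: dG.
- exact: BG.
- exact: G0.
Qed.

End Isometry.

End Automorphism.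

(** * The Gram matrix of the derivative of an automorphism *)

Section Jacobian.
Context {R : realType} {n : nat}.
Local Notation C := (Cplx R).
(** Polarization over C: [x + y] gives [b x y + b y x = 0], and [x + 'i *: y] gives
    [b y x = b x y]. *)
Lemma sesquilinear_eq0 (V : lmodType C) (b : V -> V -> C) :
  (forall x x' y, b (x + x') y = b x y + b x' y) ->
  (forall x y y', b x (y + y') = b x y + b x y') ->
  (forall x y, b ('i *: x) y = 'i * b x y) ->
  (forall x y, b x ('i *: y) = - 'i * b x y) ->
  (forall x, b x x = 0) -> forall x y, b x y = 0.
Proof.
move=> bDl bDr bil bir b0 x y.
have := b0 (x + y); rewrite bDl !bDr !b0 add0r addr0 => E1.
have := b0 (x + 'i *: y); rewrite bDl !bDr !b0 add0r addr0 bil bir => E2.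
have i0 : ('i : C) != 0 by apply/eqP => -[] /eqP; rewrite oner_eq0.
have E3 : b y x = b x y.
  apply: (mulfI i0); apply/eqP; rewrite -subr_eq0; apply/eqP; apply: etrans E2.
  by rewrite addrC mulNr.
have : 2 * b x y = 0 by apply: etrans E1; rewrite E3; ring.
by move=> /eqP; rewrite mulf_eq0 pnatr_eq0 /= => /eqP.
Qed.

Implicit Types (u v w z h x y : 'rV[C]_n).

Section Schwarz_Pick.
Variables (w : 'rV[C]_n) (s : C) (theta : 'rV[C]_n -> 'rV[C]_n).
Hypotheses (Bw : unit_ball w) (s_gt0 : 0 < s) (sE : s ^+ 2 = 1 - dotmx w w).
Hypotheses (autT : automorphism_of unit_ball theta) (thw : theta w = 0).
Local Notation L := (mobius_lin w s).

Lemma derive_automorphism_norm x :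
  dotmx ('D_x theta w) ('D_x theta w)
  = (s ^- 2) ^+ 2 * (s ^+ 2 * dotmx x x + dotmx x w * dotmx w x).
Proof.
have s20 : s ^+ 2 != 0 by rewrite expf_neq0// gt_eqF.
have cj : Num.conj (s ^- 2) = s ^- 2.
  by apply: geC0_conj; rewrite invr_ge0; apply: exprn_ge0; exact: ltW.
(* The preimage of [x] under the derivative of the Moebius map at 0. As the map is an involution,
   this is its derivative at [w] applied to [x]. *)
pose h := - s ^- 2 *: L x.
have hx : 'D_h (mobius w s) 0 = x.
  rewrite derive_mobius_0 /h mobius_linZ (mobius_linK s_gt0 sE) dotmxZl.
  rewrite (dotmx_mobius_lin_w s_gt0 sE) scalerDr !scalerA opprD addrCA subrr.
  by rewrite addr0 mulNr mulVf// scaleN1r opprK.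
have := automorphism_isometry Bw s_gt0 sE autT thw h; rewrite hx => ->.
rewrite /h scaleNr dotmxNl dotmxNr opprK dotmxZl dotmxZr cj.
by rewrite (dotmx_mobius_lin2 s_gt0 sE) mulrA -expr2.
Qed.

(** Both sides are sesquilinear and agree for [x = y] by [derive_automorphism_norm]. *)
Lemma jacobian_gram x y :
  dotmx (x *m jacobian theta w) (y *m jacobian theta w)
  = (s ^- 2) ^+ 2 * (s ^+ 2 * dotmx x y + dotmx x w * dotmx w y).
Proof.
have [[_ dth] _ _] := autT.
apply/eqP; rewrite -subr_eq0; apply/eqP.
pose b x y := dotmx (x *m jacobian theta w) (y *m jacobian theta w)
  - (s ^- 2) ^+ 2 * (s ^+ 2 * dotmx x y + dotmx x w * dotmx w y).
have linl (t a1 a2 c d1 d2 f1 f2 g : C) :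
    a1 + a2 - t * (c * (d1 + d2) + (f1 + f2) * g)
    = a1 - t * (c * d1 + f1 * g) + (a2 - t * (c * d2 + f2 * g)) by ring.
have linr (t a1 a2 c d1 d2 f g1 g2 : C) :
    a1 + a2 - t * (c * (d1 + d2) + f * (g1 + g2))
    = a1 - t * (c * d1 + f * g1) + (a2 - t * (c * d2 + f * g2)) by ring.
apply: (@sesquilinear_eq0 _ b); rewrite /b.
- by move=> x1 x2 y1; rewrite mulmxDl !dotmxDl linl.
- by move=> x1 y1 y2; rewrite mulmxDl !dotmxDr linr.
- move=> x1 y1; rewrite -scalemxAl !dotmxZl.
  set a := dotmx (_ *m _) _; move: (dotmx x1 y1) (dotmx x1 w) (dotmx w y1) => c d e.
  by move: a => a; ring.
- move=> x1 y1; rewrite -scalemxAl !dotmxZr conj_i.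
  set a := dotmx (_ *m _) _; move: (dotmx x1 y1) (dotmx x1 w) (dotmx w y1) => c d e.
  by move: a => a; ring.
- move=> x1; rewrite -deriveEjacobian; last exact: dth.
  by rewrite derive_automorphism_norm subrr.
Qed.

End Schwarz_Pick.

End Jacobian.

(** * Localizations *)

Lemma continuous_along (K : numFieldType) (V W : normedModType K) (f : V -> W)
    (U : set V) (a b : V) (e : K) :
  open U -> U b -> {for b, continuous f} -> 0 < e ->
  exists2 dl : K, 0 < dl & forall t : K, `|t| < dl ->
    U (t *: a + b) /\ `|f (t *: a + b) - f b| <= e.
Proof.
move=> oU Ub cf e0.
have : \forall x \near b, U x /\ `|f x - f b| <= e.
  near=> x; split; first by near: x; exact: open_nbhs_nbhs.
  by rewrite distrC; near: x; exact: (@cvgr_dist_le _ _ _ _ _ f (f b) cf).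
move=> /nbhs_ballP[r /= r0 B].
have a1 : 0 < `|a| + 1 by rewrite ltr_wpDl.
exists (r / (`|a| + 1)); first by rewrite divr_gt0.
move=> t; rewrite ltr_pdivlMr// => tr; apply: B.
rewrite -ball_normE /ball_ /= distrC addrK normrZ.
by apply: le_lt_trans tr; rewrite ler_wpM2l// lerDl.
Unshelve. all: by end_near. Qed.

Section Localization.
Context {R : realType} {n : nat}.
Local Notation C := (Cplx R).
Context (H : completeNormedModType C).
Implicit Types (u v w z x y : 'rV[C]_n).
Variable (T : 'I_n -> {linear H -> H}).
Hypothesis cT : forall k, continuous (T k).

Lemma continuous_shifted w k : continuous (shifted T w k).
Proof.
move=> h; rewrite /shifted; apply: cvgB; first exact: cT.
by apply: cvgZ; [exact: cvg_cst|exact: cvg_id].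
Qed.

(* Differentiating (T_k - z_k) gam z = 0 at w. *)
Lemma shifted_derive_frame (gam : 'rV[C]_n -> H) (U : set 'rV[C]_n) w v k :
  open U -> U w -> differentiable gam w ->
  (forall z, U z -> joint_kernel T z (gam z)) ->
  shifted T w k ('D_v gam w) = v 0 k *: gam w.
Proof.
move=> oU Uw dg kg.
have g0 : shifted T w k (gam w) = 0 by exact: kg.
have dS : differentiable (shifted T w k) (gam w).
  by apply: linear_differentiable; exact: continuous_shifted.
have <- : 'D_v (shifted T w k \o gam) w = shifted T w k ('D_v gam w).
  rewrite (derive_comp v dg dS) (deriveE _ dS).
  by rewrite diff_lin//; exact: continuous_shifted.
apply: derive_val; apply/is_deriveP => e e0.
have c1 : 0 < `|v 0 k| + 1 by rewrite ltr_wpDl.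
have [dl dl0 B] := continuous_along v oU Uw (differentiable_continuous dg)
  (divr_gt0 e0 c1).
exists dl => // t /B[Ut Gt].
(* On the kernel at [z], [T k - w 0 k] is multiplication by [z 0 k - w 0 k]. *)
have E : shifted T w k (gam (t *: v + w)) = (t * v 0 k) *: gam (t *: v + w).
  have := kg _ Ut k; rewrite /shifted !mxE => /eqP; rewrite subr_eq0 => /eqP ->.
  by rewrite -scalerBl addrK.
rewrite /= E g0 subr0 scalerA -scalerBr normrZ normrM -mulrA.
rewrite [leRHS]mulrC ler_wpM2l//.
apply: (@le_trans _ _ ((`|v 0 k| + 1) * (e / (`|v 0 k| + 1)))).
  by apply: ler_pM => //; rewrite lerDl.
by rewrite mulrC divfK// gt_eqF.
Qed.

Lemma localization_homZ w f a h :
  localization_hom T w f (a *: h) = a *: localization_hom T w f h.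
Proof.
rewrite /localization_hom scalerDr !scalerA [f w * a]mulrC; congr (_ + _).
rewrite scaler_sumr; apply: eq_bigr => k _.
by rewrite linearZ /= !scalerA mulrC.
Qed.

Lemma localization_spaceZ w a h :
  localization_space T w h -> localization_space T w (a *: h).
Proof. by move=> Mh i j; rewrite !linearZ /= Mh scaler0. Qed.

(** Passes from the extended suprema to a norm inequality for one vector by normalizing [h]. *)
Lemma contractive_localization_le w f h : contractive_localization T w ->
  holomorphic_near_closed_ball f -> (forall z, unit_ball z -> `|f z| <= 1) ->
  localization_space T w h -> `|localization_hom T w f h| <= `|h|.
Proof.
move=> cL hf f1 Mh.
have [->|h0] := eqVneq h 0.
  by rewrite -(scale0r 0) localization_homZ !scale0r.
have hn : 0 < `|h| by rewrite normr_gt0.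
pose h' := `|h|^-1 *: h.
have h'1 : `|h'| = 1 by rewrite normrZ normfV normr_id mulVf// gt_eqF.
have hE : h = `|h| *: h' by rewrite scalerA divff ?scale1r// gt_eqF.
have S : (sup_norm_on unit_ball f <= 1)%E.
  apply: ge_ereal_sup => _ [z Bz <-]; rewrite lee_fin -lecR.
  by rewrite RRe_real ?normr_real//; exact: f1.
have A : ((complex.Re `|localization_hom T w f h'|)%:E <= 1)%E.
  apply: le_trans S; apply: le_trans (cL f hf); apply: ereal_sup_ubound.
  by exists h' => //; split; [exact: localization_spaceZ|rewrite /= h'1].
have {}A : `|localization_hom T w f h'| <= 1.
  by move: A; rewrite lee_fin -lecR RRe_real ?normr_real.
rewrite {1}hE localization_homZ normrZ normr_id.
by rewrite ler_piMr// ltW.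
Qed.

End Localization.

(** * Test functions built on the Moebius map *)

Section TestFunctions.
Context {R : realType} {n : nat}.
Local Notation C := (Cplx R).
Implicit Types (u v z x y : 'rV[C]_n).
Variables (w : 'rV[C]_n) (s : C).
Hypotheses (Bw : unit_ball w) (s_gt0 : 0 < s) (sE : s ^+ 2 = 1 - dotmx w w).
Local Notation L := (mobius_lin w s).
Local Notation phi := (mobius w s).

(** If [dotmx z w] were 1, continuity would give a point [y] of the open ball with
    [|1 - dotmx y w| < 1 - |w|], against [|dotmx y w| <= |w|]; here [|w|] is the Euclidean
    length. *)
Lemma closed_ball_dotmx_neq1 z : closure unit_ball z -> 1 - dotmx z w != 0.
Proof.
move=> cz; rewrite subr_eq0; apply/eqP => zw.
have q1 : sqrtC (dotmx w w) < 1.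
  rewrite -(ltr_sqr (x := sqrtC _)) ?nnegrE ?sqrtC_ge0 ?dotmx_ge0//.
  by rewrite sqrtCK expr1n; exact: Bw.
have e0 : 0 < 1 - sqrtC (dotmx w w) by rewrite subr_gt0.
have cd := differentiable_continuous (differentiable_dotmx w z).
have nz : nbhs z [set x | `|dotmx z w - dotmx x w| < 1 - sqrtC (dotmx w w)].
  exact: (@cvgr_dist_lt _ _ _ _ _ (fun x => dotmx x w) (dotmx z w) cd).
have [y [By /=]] := cz _ nz; rewrite -zw => dyw.
have yq : `|dotmx y w| <= sqrtC (dotmx w w).
  rewrite -ler_sqr ?nnegrE ?sqrtC_ge0 ?dotmx_ge0//.
  rewrite sqrtCK; apply: (le_trans (dotmx_CS _ _)).
  by apply: ler_piMl; [exact: dotmx_ge0|apply: ltW; exact: By].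
have := ler_normD (1 - dotmx y w) (dotmx y w); rewrite subrK normr1 => K.
by have := le_lt_trans K (ltr_leD dyw yq); rewrite subrK ltxx.
Qed.

Lemma holomorphic_near_mobius v :
  holomorphic_near_closed_ball (fun z => dotmx (phi z) v).
Proof.
exists [set z | 1 - dotmx z w != 0]; first exact: closed_ball_dotmx_neq1.
have cd z : {for z, continuous (fun x : 'rV[C]_n => 1 - dotmx x w : C)}.
  apply: differentiable_continuous; apply: differentiableB.
    exact: differentiable_cst.
  exact: differentiable_dotmx.
split.
  rewrite openE => z /= z0.
  exact: (@cvgr_neq0 _ _ _ _ _ _ _ (cd z) z0).
move=> z z0; have dphi := differentiable_mobius s z0.
have dd := differentiable_dotmx v (phi z).
exact: (@differentiable_comp _ _ _ _ phi (fun x => dotmx x v) z dphi dd).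
Qed.

Lemma mobius_test_le1 v z : dotmx v v <= 1 -> unit_ball z ->
  `|dotmx (phi z) v| <= 1.
Proof.
move=> v1 Bz; rewrite -(ler_sqr (x := `|_|)) ?nnegrE ?normr_ge0 ?ler01//.
rewrite expr1n; apply: (le_trans (dotmx_CS _ _)).
have pz : dotmx (phi z) (phi z) <= 1.
  by apply: ltW; exact: (mobius_ball Bw s_gt0 sE Bz).
apply: le_trans v1; apply: ler_piMl => //; exact: dotmx_ge0.
Qed.

Lemma dotmx_sum x y : dotmx x y = \sum_k x 0 k * dotmx (delta_mx 0 k) y.
Proof.
rewrite {1}[x]row_sum_delta.
have -> : dotmx (\sum_j x 0 j *: delta_mx 0 j) y
    = \sum_j dotmx (x 0 j *: delta_mx 0 j) y.
  exact: (linear_sumlz (@dotmx C n)).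
by apply: eq_bigr => k _; rewrite dotmxZl.
Qed.

Context (H : completeNormedModType C) (T : 'I_n -> {linear H -> H}).

(** The test function vanishes at [w], so only the linear term remains; its coefficients against [x]
    sum to the derivative along [x], which [derive_mobius_w] gives. *)
Lemma localization_hom_mobius v x (g h : H) :
  (forall k, shifted T w k h = x 0 k *: g) ->
  localization_hom T w (fun z => dotmx (phi z) v) h
  = - (s ^- 2 * dotmx (L x) v) *: g.
Proof.
move=> sh; rewrite /localization_hom (mobius_w s_gt0 sE) dotmx0l scale0r add0r.
have E k : partial k (fun z => dotmx (phi z) v) w
    = - (s ^- 2 * dotmx (delta_mx 0 k) (L v)).
  rewrite /partial.
  have dw : differentiable phi w by apply: differentiable_mobius; exact: (ball_dotmx_neq1 Bw Bw).
  have [_ ->] := is_derive_dotmx (delta_mx 0 k) v dw.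
  by rewrite (derive_mobius_w Bw s_gt0 sE) dotmxNl dotmxZl (mobius_lin_sym w s_gt0).
under eq_bigr => k _ do rewrite E sh scalerA.
rewrite -scaler_suml -(mobius_lin_sym w s_gt0) (dotmx_sum x (L v)); congr (_ *: _).
rewrite mulr_sumr -sumrN; apply: eq_bigr => k _.
by rewrite mulNr -mulrA [_ * x 0 k]mulrC.
Qed.

Lemma contractive_mobius_bound x (g h : H) : contractive_localization T w ->
  localization_space T w h -> (forall k, shifted T w k h = x 0 k *: g) ->
  (s ^- 2) ^+ 2 * dotmx (L x) (L x) * `|g| ^+ 2 <= `|h| ^+ 2.
Proof.
move=> cT Mh sh.
have s2 : 0 < s ^- 2 by rewrite invr_gt0; exact: exprn_gt0.
have Q0 := dotmx_ge0 (L x).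
have [Qz|Qn] := eqVneq (dotmx (L x) (L x)) 0.
  by rewrite Qz mulr0 mul0r; exact: exprn_ge0.
have q0 : 0 < sqrtC (dotmx (L x) (L x)) by rewrite sqrtC_gt0 lt_def Qn.
have := sqrtCK (dotmx (L x) (L x)).
move: (sqrtC _) q0 => q q0 qE.
(* The test function <phi z, v> with v = L x / |L x| is optimal. *)
pose v := q^-1 *: L x.
have cj : Num.conj q^-1 = q^-1 by apply: geC0_conj; rewrite invr_ge0; exact: ltW.
have v1 : dotmx v v = 1.
  rewrite dotmxZl dotmxZr cj -qE expr2 mulKf ?mulVf// gt_eqF//.
have Lv : dotmx (L x) v = q.
  by rewrite dotmxZr cj -qE expr2 mulKf// gt_eqF.
have v1' : dotmx v v <= 1 by rewrite v1.
have := contractive_localization_le cT (holomorphic_near_mobius v)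
  (fun z Bz => mobius_test_le1 v1' Bz) Mh.
rewrite (localization_hom_mobius v sh) Lv normrZ normrN.
rewrite (gtr0_norm (mulr_gt0 s2 q0)) => K.
rewrite -qE -!exprMn ler_sqr ?nnegrE ?normr_ge0//.
by apply: mulr_ge0; [apply: ltW; exact: mulr_gt0|exact: normr_ge0].
Qed.

End TestFunctions.

(** * Matrix entries and Hermitian forms *)

Section CurvatureMatrix.
Context {R : realType} {n : nat}.
Local Notation C := (Cplx R).
Implicit Types (u v w z x y : 'rV[C]_n).

Lemma hermsymmx_entries (A : 'M[C]_n) :
  (forall i j, A i j = Num.conj (A j i)) -> A \is hermsymmx.
Proof.
move=> AE; apply/is_hermitianmxP; apply/matrixP => i j.
by rewrite expr0 scale1r !mxE.
Qed.

Lemma sesquilinear_mulmx (b : 'rV[C]_n -> 'rV[C]_n -> C) (A : 'M[C]_n) x :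
  (forall u u' v, b (u + u') v = b u v + b u' v) ->
  (forall u v v', b u (v + v') = b u v + b u v') ->
  (forall a u v, b (a *: u) v = a * b u v) ->
  (forall a u v, b u (a *: v) = Num.conj a * b u v) ->
  (forall i j, A i j = b (delta_mx 0 i) (delta_mx 0 j)) ->
  (x *m A *m (map_mx Num.conj x)^T) 0 0 = b x x.
Proof.
move=> bDl bDr bZl bZr AE.
have bl u v : b u v = \sum_i u 0 i * b (delta_mx 0 i) v.
  rewrite {1}[u]row_sum_delta (big_morph (b^~ v) (id1 := 0) (op1 := +%R)) //.
    by apply: eq_bigr => i _; rewrite bZl.
  by rewrite -(scale0r 0) bZl mul0r.
have br u v : b u v = \sum_j Num.conj (v 0 j) * b u (delta_mx 0 j).
  rewrite {1}[v]row_sum_delta (big_morph (b u) (id1 := 0) (op1 := +%R)) //.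
    by apply: eq_bigr => i _; rewrite bZr.
  by rewrite -(scale0r 0) bZr rmorph0 mul0r.
rewrite br mxE; apply: eq_bigr => j _; rewrite !mxE mulrC; congr (_ * _).
by rewrite bl; apply: eq_bigr => i _; rewrite AE.
Qed.

Lemma jacobian_matrix_gram (theta : 'rV[C]_n -> 'rV[C]_n) (w : 'rV[C]_n) i j :
  ((jacobian_matrix theta w)^T *m map_mx Num.conj (jacobian_matrix theta w)) i j
  = dotmx (delta_mx 0 i *m jacobian theta w) (delta_mx 0 j *m jacobian theta w).
Proof.
rewrite /jacobian_matrix trmxK -!rowE dotmxE !mxE; apply: eq_bigr => k _.
by rewrite !mxE.
Qed.

Lemma dotmx_delta_l x j : dotmx (delta_mx 0 j) x = Num.conj (x 0 j).
Proof. by rewrite dotmxC dotmx_delta. Qed.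

(** [jacobian_gram] on basis vectors and [ball_curvatureE] give the same entries once
    [1 - dotmx w w] is written [s ^+ 2]. *)
Lemma ball_curvature_automorphism (theta : 'rV[C]_n -> 'rV[C]_n) (w : 'rV[C]_n) :
  unit_ball w -> automorphism_of unit_ball theta -> theta w = 0 ->
  - ((jacobian_matrix theta w)^T *m map_mx Num.conj (jacobian_matrix theta w))
  = ball_curvature w.
Proof.
move=> Bw aut thw.
have [s s_gt0 sE] : exists2 s : C, 0 < s & s ^+ 2 = 1 - dotmx w w.
  exists (sqrtC (1 - dotmx w w)); last exact: sqrtCK.
  by rewrite sqrtC_gt0 subr_gt0; exact: Bw.
have [[oB _] _ _] := aut.
have s0 : s != 0 by rewrite gt_eqF.
rewrite (ball_curvatureE oB Bw); congr (- _); apply/matrixP => i j.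
rewrite jacobian_matrix_gram (jacobian_gram Bw s_gt0 sE aut thw) -sE.
rewrite [RHS]mxE dotmx_delta dotmx_delta_l dotmx_delta.
rewrite (_ : delta_mx 0 i 0 j = (i == j)%:R); last by rewrite mxE eqxx eq_sym.
move: (Num.conj (w 0 i)) (w 0 j) (i == j)%:R => a b c.
by field.
Qed.

Lemma dotmx_jacobian (theta : 'rV[C]_n -> 'rV[C]_n) (w : 'rV[C]_n) (s : C) x :
  unit_ball w -> 0 < s -> s ^+ 2 = 1 - dotmx w w ->
  automorphism_of unit_ball theta -> theta w = 0 ->
  dotmx (x *m jacobian theta w) (x *m jacobian theta w)
  = (s ^- 2) ^+ 2 * dotmx (mobius_lin w s x) (mobius_lin w s x).
Proof.
move=> Bw s_gt0 sE aut thw.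
by rewrite (jacobian_gram Bw s_gt0 sE aut thw) (dotmx_mobius_lin2 s_gt0 sE).
Qed.

End CurvatureMatrix.

Unset Implicit Arguments.

Theorem theorem4p2 (R : realType) (n : nat)
  (H : completeNormedModType (Cplx R)) (dot : {dot H for Num.conj})
  (hH : is_hilbert dot)
  (T : 'I_n -> {linear H -> H}) (hT : cowen_douglas1 T unit_ball)
  (w : 'rV[Cplx R]_n) (hw : unit_ball w)
  (theta : 'rV[Cplx R]_n -> 'rV[Cplx R]_n)
  (htheta : automorphism_of unit_ball theta) (htheta0 : theta w = 0)
  (KT : 'M[Cplx R]_n) (hKT : is_curvature_of T w KT)
  (hcontr : contractive_localization T w) :
  let D := jacobian_matrix theta w in
  hermitian_le KT (- (D^T *m map_mx Num.conj D)) /\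
  - (D^T *m map_mx Num.conj D) = ball_curvature w.
Proof.
move=> D; split; last exact: ball_curvature_automorphism.
have [cT _ _ _ _] := hT.
have [gam [U [Uw [oU dg] kg]] KE] := hKT.
have [s s_gt0 sE] : exists2 s : Cplx R, 0 < s & s ^+ 2 = 1 - dotmx w w.
  exists (sqrtC (1 - dotmx w w)); last exact: sqrtCK.
  by rewrite sqrtC_gt0 subr_gt0; exact: hw.
have dgw : differentiable gam w by exact: dg.
have {}KE := etrans KE (curvature_gram hH oU Uw dg (fun z Uz => (kg z Uz).1)).
have gn : 0 < `|gam w| by rewrite normr_gt0; exact: (kg w Uw).1.
have N0 : 0 < `|gam w| ^+ 2 by exact: exprn_gt0.
have Ncj : Num.conj (`|gam w| ^+ 2) = `|gam w| ^+ 2 by apply: geC0_conj; exact: ltW.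
move: KE; set g := gam w; set N := _ ^+ 2 in N0 Ncj * => KE.
have NE : N = dot g g by rewrite hH.
pose G x := 'D_x gam w.
have GD x y : G (x + y) = G x + G y by rewrite /G !deriveE// linearD.
have GZ a x : G (a *: x) = a *: G x.
  by rewrite /G !deriveE// linearZ.
have KTE i j : KT i j = - (dot ('D_(delta_mx 0 i) gam w) ('D_(delta_mx 0 j) gam w) / N
    - dot g ('D_(delta_mx 0 j) gam w) * dot ('D_(delta_mx 0 i) gam w) g / N ^+ 2).
  by rewrite KE !mxE.
split.
- apply: hermsymmx_entries => i j; rewrite !KTE rmorphN rmorphB; congr (- (_ - _)).
    by rewrite rmorphM fmorphV /= Ncj -(dot_conj dot).
  rewrite !rmorphM fmorphV rmorphXn /= Ncj -!(dot_conj dot).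
  by rewrite [X in X / _]mulrC.
- apply: hermsymmx_entries => i j; rewrite mxE [X in Num.conj X]mxE.
  by rewrite !jacobian_matrix_gram rmorphN /= -dotmxC.
move=> x.
(* The sesquilinear form of the difference of the two sides, with [- KT] in Gram form. *)
pose b u v := dot (G u) (G v) / N - dot g (G v) * dot (G u) g / N ^+ 2
  - dotmx (u *m jacobian theta w) (v *m jacobian theta w).
have sc (k p q r t m c : Cplx R) : k * p / m - q * (k * r) / m ^+ 2 - k * c
    = k * (p / m - q * r / m ^+ 2 - c) by ring.
have sc' (k p q r m c : Cplx R) : k * p / m - k * q * r / m ^+ 2 - k * c
    = k * (p / m - q * r / m ^+ 2 - c) by ring.
have ad (p p' q r r' m c c' : Cplx R) :
    (p + p') / m - q * (r + r') / m ^+ 2 - (c + c')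
    = p / m - q * r / m ^+ 2 - c + (p' / m - q * r' / m ^+ 2 - c') by ring.
have ad' (p p' q q' r m c c' : Cplx R) :
    (p + p') / m - (q + q') * r / m ^+ 2 - (c + c')
    = p / m - q * r / m ^+ 2 - c + (p' / m - q' * r / m ^+ 2 - c') by ring.
rewrite (@sesquilinear_mulmx _ _ b).
- rewrite /b (dotmx_jacobian _ hw s_gt0 sE htheta htheta0).
  (* [c *: g] is the orthogonal projection of [G x] on [g]. Removing it leaves the action of
     [shifted T w k] unchanged and makes the norm as small as possible, so that the bound is
     sharp. *)
  have [c cN] : exists c : Cplx R, c = dot (G x) g / N by exists (dot (G x) g / N).
  pose h := G x - c *: g.
  have sg k : shifted T w k g = 0 by exact: (kg w Uw).2.
  have sh k : shifted T w k h = x 0 k *: g.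
    rewrite /h linearB linearZ /= sg scaler0 subr0.
    exact: (shifted_derive_frame cT x k oU Uw dgw (fun z Uz => (kg z Uz).2)).
  have Mh : localization_space T w h.
    by move=> i j; rewrite sh linearZ /= sg scaler0.
  have := contractive_mobius_bound hw s_gt0 sE hcontr Mh sh.
  rewrite -/N -(hH h); move: (_ * dotmx _ _) => Q QN.
  have hE : dot h h = dot (G x) (G x) - dot g (G x) * dot (G x) g / N.
    rewrite /h (dnormB dot) (dnormZ dot) linearZr_LR /= -NE.
    have cE : Num.conj c = dot g (G x) / N.
      by rewrite cN rmorphM fmorphV /= Ncj -(dot_conj dot).
    rewrite normCK rmorphM /= conjCK cE -(dot_conj dot g (G x)) cN.
    move: (dot (G x) (G x)) (dot (G x) g) (dot g (G x)) (N) (gt_eqF N0).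
    by move=> a p q m /negbT m0; field.
  move: QN; rewrite hE -subr_ge0 => QN.
  (* After multiplication by [N], the claim is the bound [QN] with [dot h h] expanded. *)
  rewrite -(pmulr_lge0 _ N0).
  move: QN; congr (0 <= _).
  move: (dot (G x) (G x)) (dot (G x) g) (dot g (G x)) (N) (gt_eqF N0).
  by move=> a p q m /negbT m0; field.
- by move=> u u' v; rewrite /b GD mulmxDl !(linearDl dot) dotmxDl ad.
- by move=> u v v'; rewrite /b GD mulmxDl !(linearDr dot) dotmxDr ad'.
- by move=> a u v; rewrite /b GZ -scalemxAl !(linearZl_LR dot) dotmxZl sc.
- by move=> a u v; rewrite /b GZ -scalemxAl !(linearZr_LR dot) dotmxZr sc'.
- move=> i j; rewrite mxE [X in X + _]mxE [X in _ + X]mxE jacobian_matrix_gram.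
  by rewrite KTE opprK /b /G; exact: addrC.
Qed.
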